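(* In the network attack model described in the context, $$E\left[W_\rho\right]=\frac{1}{\xi}\left(\frac{\lambda+b\mu}{a\mu}+M-(M-1)e^{-\xi V}\sum_{j=0}^{M-2}\frac{(\xi V)^j}{j!}+e^{-\xi V}\sum_{j=0}^{M-2}\frac{(\xi V)^j}{(j-1)!}\right)=\frac{E[N_\rho]}{\xi}=E[w_{11}]\,E[N_\rho],$$ where the $j=0$ term of the last sum is $0$ (i.e. $\frac{1}{(-1)!}=0$).
   Context: Model. Let $\lambda,\mu,\xi>0$, $a\in(0,1)$, $b=1-a$, $M\in\{1,2,3,\dots\}$, $V>0$. Attacks occur at the points $0<t_1<t_2<\cdots$ of a Poisson process of rate $\lambda$ on $[0,\infty)$. The $k$th attack ($k\ge1$) incapacitates $n_k$ nodes of total weight $w_k=w_{k1}+\cdots+w_{kn_k}$, where the $n_k$ are iid geometric, $P(n_k=j)=ab^{j-1}$ for $j\ge1$, and the $w_{kj}$ are iid exponential with rate $\xi$ (mean $1/\xi$). Set $N(t)=\sum_{k:\,t_k\le t}n_k$ and $W(t)=\sum_{k:\,t_k\le t}w_k$ (zero initial state). The process is observed only at times $\tau_0=0<\tau_1<\tau_2<\cdots$, where $\tau_k-\tau_{k-1}$, $k\ge1$, are iid exponential with rate $\mu$. The families $(t_k)$, $(n_k)$, $(w_{kj})$, $(\tau_k-\tau_{k-1})$ are mutually independent. Write $N_k=N(\tau_k)$, $W_k=W(\tau_k)$. The first observed passage index is $$\rho=\inf\{k\ge0:(N_k,W_k)\notin[0,M)\times[0,V)\},$$ $\tau_\rho$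 is the first observed passage time, and $N_\rho=N(\tau_\rho)$, $W_\rho=W(\tau_\rho)$. Empty sums (as when $M=1$) are $0$. *)

(* Defs.v *)
From HB Require Import structures.
From mathcomp Require Import all_boot all_order all_algebra finmap.
From mathcomp Require Import all_classical all_reals all_analysis.

Set Implicit Arguments.
Unset Strict Implicit.
Unset Printing Implicit Defensive.

Import Order.TTheory GRing.Theory Num.Theory.
Import numFieldNormedType.Exports.

Local Open Scope classical_set_scope.
Local Open Scope ring_scope.

(* The paper's sequences t_k, n_k, w_kj (k, j >= 1) are indexed from 0 here:
   t k, n k, x k j stand for t_(k+1), n_(k+1), w_(k+1)(j+1), and delta k is the
   observation gap tau_(k+1) - tau_k. *)

Section Independence.
Context d (T : measurableType d) (R : realType) (P : probability T R).

Definition mutually_independent (I : choiceType) (G : I -> set (set T)) : Prop :=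
  forall (J : {fset I}) (A : I -> set T), (forall i, i \in J -> G i (A i)) ->
    P (\bigcap_(i in [set` J]) A i) = (\prod_(i <- J) P (A i))%E.

Definition rv_system d' (T' : measurableType d') (X : T -> T') : set (set T) :=
  [set X @^-1` B | B in measurable].

Definition independent_rvs (I : choiceType) d' (T' : measurableType d')
    (X : I -> T -> T') : Prop :=
  mutually_independent (fun i => rv_system (X i)).

Definition sigma_family (I : Type) d' (T' : measurableType d')
    (X : I -> T -> T') : set (set T) :=
  <<s \bigcup_i rv_system (X i) >>.

Definition independent4 (G1 G2 G3 G4 : set (set T)) : Prop :=
  mutually_independent (fun i : 'I_4 => nth set0 [:: G1; G2; G3; G4] i).

End Independence.

Section PoissonPoints.
Context d (T : measurableType d) (R : realType) (P : probability T R).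

(* The event that exactly m of the points t_0, t_1, ... lie in ]r, s]. *)
Definition count_event (t : nat -> T -> R) (r s : R) (m : nat) : set T :=
  [set omega | ([set k | (r < t k omega <= s)%R] #= `I_m)%card].

(* The points of a Poisson process of rate lam on [0, +oo[, listed in
   increasing order; ordering is only required almost surely. *)
Record poisson_points (lam : R) (t : nat -> T -> R) : Prop := {
  poisson_points_sorted :
    {ae P, forall omega, 0 < t 0%N omega /\
                         forall k, t k omega < t k.+1 omega} ;
  poisson_points_law : forall (r s : R) (m : nat), 0 <= r -> r < s ->
    P (count_event t r s m) = (poisson_pmf (lam * (s - r)) m)%:E ;
  poisson_points_indep : forall s : nat -> R,
    0 <= s 0%N -> (forall i, s i < s i.+1) ->
    mutually_independent P
      (fun i => [set count_event t (s i) (s i.+1) m | m in [set: nat]])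
}.

End PoissonPoints.

Section NetworkAttack.
Context d (T : measurableType d) (R : realType) (P : probability T R).
Implicit Types (t delta : nat -> {RV P >-> R}) (n : nat -> {RV P >-> nat})
  (x : nat -> nat -> {RV P >-> R}).

Record network_attack (lam mu xi a b : R) t n x delta : Prop := {
  attack_times : poisson_points P lam t ;
  attack_sizes_law : forall k j, (0 < j)%N ->
    P (n k @^-1` [set j]) = (a * b ^+ j.-1)%:E ;
  attack_sizes_indep : independent_rvs P n ;
  node_weights_law : forall k j A, measurable A ->
    distribution P (x k j) A = exponential_prob xi A ;
  node_weights_indep :
    independent_rvs P (fun kj : nat * nat => x kj.1 kj.2) ;
  observation_gaps_law : forall k A, measurable A ->
    distribution P (delta k) A = exponential_prob mu A ;
  observation_gaps_indep : independent_rvs P delta ;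
  families_indep :
    independent4 P (sigma_family t) (sigma_family n)
      (sigma_family (fun kj : nat * nat => x kj.1 kj.2)) (sigma_family delta)
}.

Definition observation_time delta (k : nat) (omega : T) : R :=
  \sum_(i < k) delta i omega.

(* The sums range over all attacks up to time s, which may be infinitely many
   on a null event; hence the values in the extended reals. *)
Definition nodes_lost t n (s : R) (omega : T) : \bar R :=
  (\sum_(k <oo | (t k omega <= s)%R) ((n k omega)%:R)%:E)%E.

Definition attack_weight n x (k : nat) (omega : T) : R :=
  \sum_(j < n k omega) x k j omega.

Definition weight_lost t n x (s : R) (omega : T) : \bar R :=
  (\sum_(k <oo | (t k omega <= s)%R) (attack_weight n x k omega)%:E)%E.

Definition observed_nodes t n delta (k : nat) (omega : T) : \bar R :=
  nodes_lost t n (observation_time delta k omega) omega.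

Definition observed_weight t n x delta (k : nat) (omega : T) : \bar R :=
  weight_lost t n x (observation_time delta k omega) omega.

Definition exited (M : nat) (V : R) t n x delta (omega : T) (k : nat) : Prop :=
  ~ ((0 <= observed_nodes t n delta k omega < M%:R%:E)%E /\
     (0 <= observed_weight t n x delta k omega < V%:E)%E).

(* None encodes rho = +oo, the infimum of the empty set. *)
Definition passage_index (M : nat) (V : R) t n x delta (omega : T) :
    option nat :=
  match pselect (exists k, `[< exited M V t n x delta omega k >]) with
  | left ex => Some (ex_minn ex)
  | right _ => None
  end.

(* The value of Y at the passage index, +oo when that index is infinite. *)
Definition at_passage (rho : T -> option nat) (Y : nat -> T -> \bar R)
    (omega : T) : \bar R :=
  if rho omega is Some k then Y k omega else +oo%E.

Definition nodes_at_passage (M : nat) (V : R) t n x delta : T -> \bar R :=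
  at_passage (passage_index M V t n x delta) (observed_nodes t n delta).

Definition weight_at_passage (M : nat) (V : R) t n x delta : T -> \bar R :=
  at_passage (passage_index M V t n x delta) (observed_weight t n x delta).

End NetworkAttack.

(* 1 / (j - 1)!, with the convention 1 / (-1)! = 0. *)
Definition inv_pred_fact (R : realType) (j : nat) : R :=
  if j is i.+1 then (i`!%:R)^-1 else 0.

(* Main.v *)
Require Import Defs.
From HB Require Import structures.
From mathcomp Require Import all_boot all_order all_algebra finmap.
From mathcomp Require Import all_classical all_reals all_analysis.
From mathcomp Require Import measurable_realfun zify ring lra.

Set Implicit Arguments.
Unset Strict Implicit.
Unset Printing Implicit Defensive.

Import Order.TTheory GRing.Theory Num.Theory.
Import numFieldNormedType.Exports.

Local Open Scope classical_set_scope.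
Local Open Scope ring_scope.

(** Attacks are numbered from 0. Call the first [l] attacks calm when together
    they take fewer than [M] nodes, of total weight less than [V]. Both
    components only grow, so an observation is still inside the box exactly
    when the attacks that it sees are calm, and attack [l] is part of the state
    at the passage exactly when the last observation before it sees [i <= l]
    calm attacks. Let [struck l] be the indicator of that event. Then, almost
    surely,
      N_rho = sum_l (size of attack l) * struck l   and
      W_rho = sum_l (weight of attack l) * struck l
    ([at_passage_struck]). The event depends only on the attack times, the
    observation gaps and the attacks before [l], hence it is independent of the
    size and the weight of attack [l]. With S = sum_l P(struck l) this gives
    E N_rho = S / a and E W_rho = S / (a * xi) ([wald]), and thereby the last
    two equalities.

    To compute S, let p = mu / (lam + mu) and q = 1 - p. The number of attacks
    in an exponential gap is geometric: an observation that sees [l] attacks is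
    followed by one that sees [l + j] with probability p * q ^ j ([seen_tauS];
    the observation times are frozen by Fubini's theorem, and the average over
    the gap is a gamma integral). So the last observation before attack [l]
    sees [i] attacks with probability v_i * q ^ (l - i + 1), where v_i is the
    expected number of observations that see [i] attacks. These probabilities
    add up to 1 over [i <= l], for every [l], which forces v_0 = 1 / q and
    v_i = p / q for i > 0 ([nneseries_visits]). Weighting them by the
    probability that [i] attacks are calm and summing over [i] and [l] yields
      S = lam / mu + sum_i P(the first i attacks are calm)
    ([nneseries_passes], [nneseries_strikes]).

    In the last sum, the sizes of the first attacks, being geometric, add up to
    [m] for some number of attacks with probability 1 if [m = 0] and [a] if
    [m > 0] ([renewal_density]). The weights of [m] nodes add up to less than
    [V] with the probability that a Poisson variable of mean [xi * V] is at
    least [m] ([weights_law]). Summing over [m < M] gives the closed formula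
    ([sum_calm_prob], [sum_gamma_tails]).

    Independence is used in one form only. The elementary random quantities of
    the model are indexed by the type [source], and events that are measurable
    with respect to disjoint blocks of sources are independent ([block_indep]).
    Measurability with respect to a block [J] is expressed as measurability on
    the type [g_sigma_algebraType (block G J)], so that the usual closure
    properties of measurable functions apply. *)

(** * Almost sure equality and measurability *)

Section AlmostSure.
Context d (T : measurableType d) (R : realType) (mu : {measure set T -> \bar R}).

Import HBNNSimple.

(** A simple function below [f], truncated on the null set where [f] and [g]
    differ, is below [g] and has the same integral. The argument applies to
    functions not known to be measurable, such as the value at the passage. *)
Lemma ae_le_integral_setT (f g : T -> \bar R) :
  (forall x, 0 <= f x)%E -> (forall x, 0 <= g x)%E ->
  {ae mu, forall x, f x = g x} -> (\int[mu]_x f x <= \int[mu]_x g x)%E.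
Proof.
move=> f0 g0 [N [mN N0 fgN]].
have fg x : ~ N x -> f x = g x by move=> Nx; apply: contrapT => fgx; exact/Nx/fgN.
rewrite !ge0_integralTE//; apply: ge_ereal_sup => _ [h hf <-]; apply: ereal_sup_ubound.
pose h' := proj_nnsfun h (measurableC mN).
exists h' => /=.
- move=> x; rewrite mindicE; have [xN|xN] := boolP (x \in ~` N).
    by rewrite mulr1 -fg ?hf// => Nx; move: xN; rewrite inE.
  by rewrite mulr0 g0.
- rewrite -!integralT_nnsfun; apply: ae_eq_integral => //.
  + exact/measurable_EFinP.
  + exact/measurable_EFinP.
  + exists N; split=> // x /= hx; apply: contrapT => Nx; apply: hx => _.
    by rewrite mindicE mem_set// mulr1.
Qed.

Lemma ae_eq_integral_setT (f g : T -> \bar R) :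
  {ae mu, forall x, f x = g x} -> (\int[mu]_x f x = \int[mu]_x g x)%E.
Proof.
move=> fg.
have gf : {ae mu, forall x, g x = f x} by apply: filterS fg.
by rewrite [LHS]integralE [RHS]integralE; congr (_ - _)%E; apply/eqP; rewrite eq_le;
  apply/andP; split; apply: ae_le_integral_setT => //;
  [move: fg|move: gf|move: fg|move: gf]; apply: filterS => x;
  rewrite ?funeposE ?funenegE => ->.
Qed.

Lemma ae_eq_measure (A B : set T) : measurable A -> measurable B ->
  {ae mu, forall x, A x <-> B x} -> mu A = mu B.
Proof.
move=> mA mB AB.
rewrite -[A]setIT -[B]setIT -!integral_indic//; apply: ae_eq_integral_setT.
apply: filterS AB => x AB; rewrite !indicE (_ : (x \in A) = (x \in B))//.
by apply/idP/idP; rewrite !inE => /AB.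
Qed.

End AlmostSure.

Lemma measurable_bool_set d (T : measurableType d) (b : T -> bool) :
  measurable_fun setT b -> measurable [set x | b x].
Proof. by move=> mb; rewrite -[X in measurable X]setTI; exact: mb. Qed.

Lemma sum_bool_unique m (b : bool) (c : nat -> bool) :
  (forall i j, (i < m)%N -> (j < m)%N -> c i -> c j -> i = j) ->
  (b <-> exists2 i, (i < m)%N & c i) -> nat_of_bool b = (\sum_(i < m) c i)%N.
Proof.
move=> cU bc; case: (boolP b) => [/bc[i im ci]|/negP nb].
  rewrite (bigD1 (Ordinal im))//= ci big1// => -[j jm] /= ji.
  by apply/eqP; rewrite eqb0; apply/negP => cj; move/eqP: ji; apply; apply/val_inj/cU.
rewrite big1// => -[i im] _; apply/eqP; rewrite eqb0; apply/negP => ci.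
by apply: nb; apply/bc; exists i.
Qed.

Section BoolEvents.
Context d (T : measurableType d) (R : realType) (mu : {measure set T -> \bar R}).

Lemma measure_bool (b : T -> bool) : measurable_fun setT b ->
  mu [set x | b x] = (\int[mu]_x (b x)%:R%:E)%E.
Proof.
move=> mb; rewrite -[[set x | b x]]setIT -integral_indic//; last exact: measurable_bool_set.
apply: eq_integral => x _; rewrite indicE (_ : (x \in _) = b x)//.
by apply/idP/idP; rewrite inE.
Qed.

Lemma measurable_fun_bool_EFin (b : T -> bool) : measurable_fun setT b ->
  measurable_fun setT (fun x => (b x)%:R%:E : \bar R).
Proof.
move=> mb; apply/measurable_EFinP.
rewrite (_ : (fun z => _) = \1_[set z | b z]).
  by apply: measurable_indic; exact: measurable_bool_set.
apply/funext => z; rewrite indicE (_ : (z \in _) = b z)//.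
by apply/idP/idP; rewrite inE.
Qed.

(** Additivity of the measure for events that partition [b] up to a null set;
    the partition is stated pointwise, through indicators. *)
Lemma measure_ae_partition m (b : T -> bool) (c : nat -> T -> bool) :
  measurable_fun setT b -> (forall i, measurable_fun setT (c i)) ->
  {ae mu, forall x, nat_of_bool (b x) = (\sum_(i < m) c i x)%N} ->
  mu [set x | b x] = (\sum_(i < m) mu [set x | c i x])%E.
Proof.
move=> mb mc bc; rewrite measure_bool//.
under eq_bigr do rewrite measure_bool//.
rewrite -ge0_integral_sum//; last first.
  by move=> i; exact: measurable_fun_bool_EFin.
apply: ae_eq_integral_setT; apply: filterS bc => x bcx.
by rewrite bcx natr_sum sumEFin.
Qed.

End BoolEvents.

Lemma measurable_fun_select d d' (T : measurableType d) (U : measurableType d')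
    (N : T -> nat) (F : nat -> T -> U) :
  measurable_fun setT N -> (forall m, measurable_fun setT (F m)) ->
  measurable_fun setT (fun x => F (N x) x).
Proof.
move=> mN mF _ B mB; rewrite setTI.
rewrite (_ : _ @^-1` _ = \bigcup_m (N @^-1` [set m] `&` F m @^-1` B)); last first.
  by apply/seteqP; split => x /=; [exists (N x) | move=> [m _ [/= <-]]].
apply: bigcup_measurable => m _; apply: measurableI.
  by rewrite -[X in measurable X]setTI; exact: mN.
by rewrite -[X in measurable X]setTI; exact: mF.
Qed.

Lemma measurable_fun_nat d (T : measurableType d) d' (U : measurableType d')
    (N : T -> nat) (f : nat -> U) :
  measurable_fun setT N -> measurable_fun setT (fun x => f (N x)).
Proof. by move=> mN; apply: (measurable_fun_select (F := fun m _ => f m)). Qed.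

Lemma measurable_sum_nat d (T : measurableType d) (N : nat -> T -> nat) l :
  (forall i, (i < l)%N -> measurable_fun setT (N i)) ->
  measurable_fun setT (fun x => \sum_(i < l) N i x)%N.
Proof.
elim: l => [|l IH] mN.
    by under eq_fun do rewrite big_ord0; exact: measurable_cst.
under eq_fun do rewrite big_ord_recr/=.
apply: (@measurable_fun_select _ _ _ _ (N l) (fun m x => \sum_(i < l) N i x + m)%N).
  exact: mN.
move=> m; apply: (measurable_fun_nat (addn^~ m)).
by apply: IH => i il; apply: mN; exact: ltnW.
Qed.

(** * Independence of disjoint blocks of sources *)

Section PiSystems.
Context d (T : measurableType d) (R : realType) (P : probability T R).

(** The sets independent of [B] form a Dynkin system, so the pi-lambda theorem
    applies. *)
Lemma indep_sigma_l (F : set (set T)) (B : set T) :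
  setI_closed F -> (forall A, F A -> measurable A) -> measurable B ->
  (forall A, F A -> P (A `&` B) = (P A * P B)%E) ->
  forall A, <<s F >> A -> P (A `&` B) = (P A * P B)%E.
Proof.
move=> FI mF mB FB.

have PBfin : P B \is a fin_num by exact: fin_num_measure.
pose D := [set A | measurable A /\ P (A `&` B) = (P A * P B)%E].
suff DD : dynkin D.
  move=> A FA; suff [] : D A by [].
  move: A FA; rewrite -setI_closed_g_dynkin_g_sigma_algebra//.
  by apply: smallest_sub => // A FA; split; [exact: mF | exact: FB].
split.
- by split; [exact: measurableT | rewrite setTI probability_setT mul1e].
- move=> A [mA AB]; split; first exact: measurableC.
  rewrite setIC -setDE.
  have -> : B `\` A = B `\` (A `&` B).
    by rewrite setDIr setDv setU0.
  rewrite measureD//; last first.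
  - by rewrite ltey_eq fin_num_measure.
  - exact: measurableI.
  rewrite (_ : B `&` (A `&` B) = A `&` B); last by rewrite setICA setIid.
  rewrite [X in (_ - X)%E]AB probability_setC//.
  by rewrite muleBl ?fin_num_measure// ?mul1e// fin_num_adde_defr.
- move=> A tA mA; split; first by apply: bigcup_measurable => k _; have [] := mA k.
  have mA' i : measurable (A i) by have [] := mA i.
  rewrite setI_bigcupl (measure_bigcup P setT A)//.
  rewrite measure_bigcup//; last 2 first.
  + by move=> i _; exact: measurableI.
  + exact: trivIset_setIr.
  rewrite muleC -[in RHS](fineK PBfin) -nneseriesZl//.
  apply: eq_eseriesr => k _ /=. by have [_] := mA k; rewrite fineK// muleC.
Qed.

End PiSystems.

Section Blocks.
Context d (T : measurableType d) (R : realType) (P : probability T R).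
Context (I : choiceType) (G : I -> set (set T)).
Hypothesis GT : forall i, G i setT.
Hypothesis GI : forall i, setI_closed (G i).
Hypothesis Gm : forall i A, G i A -> measurable A.
Hypothesis Gind : mutually_independent P G.

Definition block (J : set I) : set (set T) := \bigcup_(i in J) G i.

(** A pi-system that generates the same sigma-algebra as [block J]. The factors
    outside [F] are [setT], which allows two cylinders to be written over a
    common finite set of indices. *)
Definition cylinders (J : set I) : set (set T) :=
  [set C | exists (F : {fset I}) (A : I -> set T),
    [/\ [set` F] `<=` J, forall i, G i (A i), forall i, i \notin F -> A i = setT
      & C = \bigcap_(i in [set` F]) A i]].

Lemma bigcap_fset_widen (F F' : {fset I}) (A : I -> set T) :
  (F `<=` F')%fset -> (forall i, i \notin F -> A i = setT) ->
  \bigcap_(i in [set` F]) A i = \bigcap_(i in [set` F']) A i.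
Proof.
move=> FF' AT; apply/seteqP; split=> x /= xA i /= iF; last first.
  by apply: xA => /=; exact: (fsubsetP FF').
by have [iF'|iF'] := boolP (i \in F); [exact: xA | rewrite AT].
Qed.

Lemma cylinders_setI J : setI_closed (cylinders J).
Proof.
move=> _ _ [F [A [FJ GA AT ->]]] [F' [A' [FJ' GA' AT' ->]]].
exists (F `|` F')%fset, (fun i => A i `&` A' i); split.
- by move=> i /=; rewrite inE => /orP[|] ?; [exact: FJ | exact: FJ'].
- by move=> i; exact: GI.
- by move=> i; rewrite inE negb_or => /andP[? ?]; rewrite AT// AT'// setTI.
- rewrite (@bigcap_fset_widen F (F `|` F')%fset)//; last exact: fsubsetUl.
  rewrite (@bigcap_fset_widen F' (F `|` F')%fset)//; last exact: fsubsetUr.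
  by rewrite bigcapI.
Qed.

Lemma cylinders_measurable J A : cylinders J A -> measurable A.
Proof.
move=> [F [A' [_ GA _ ->]]].
apply: fin_bigcap_measurable; first exact: finite_fset.
by move=> i _; exact: (Gm (GA i)).
Qed.

Lemma block_cylinders J : block J `<=` cylinders J.
Proof.
move=> A [i Ji GA]; exists [fset i]%fset, (fun k => if k == i then A else setT).
split.
- by move=> k /=; rewrite inE => /eqP ->.
- by move=> k; case: eqP => [->|].
- by move=> k; rewrite inE => /negPf ->.
- by rewrite set_fset1 bigcap_set1 eqxx.
Qed.

Lemma cylinders_indep J1 J2 A B : J1 `&` J2 = set0 ->
  cylinders J1 A -> cylinders J2 B -> P (A `&` B) = (P A * P B)%E.
Proof.
move=> J12 [F1 [A1 [FJ1 GA1 AT1 ->]]] [F2 [A2 [FJ2 GA2 AT2 ->]]].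
have disj i : i \in F1 -> i \notin F2.
  move=> i1; apply/negP => i2.
  have : (J1 `&` J2) i by split; [exact: FJ1 | exact: FJ2].
  by rewrite J12.
rewrite (@bigcap_fset_widen F1 (F1 `|` F2)%fset)//; last exact: fsubsetUl.
rewrite (@bigcap_fset_widen F2 (F1 `|` F2)%fset)//; last exact: fsubsetUr.
rewrite -bigcapI !Gind//; last first.
  by move=> i _; exact: GI.
rewrite -big_split/=; apply: eq_big_seq => i.
rewrite inE => /orP[i1|i2].
  by rewrite AT2 ?disj// setIT probability_setT mule1.
rewrite AT1; last by apply/negP => /disj; rewrite i2.
by rewrite setTI probability_setT mul1e.
Qed.

Lemma block_sigma_measurable J A : <<s block J >> A -> measurable A.
Proof.
move=> JA; have : <<s @measurable _ T >> A.
  by apply: sub_smallest2r JA => // B [i _ /Gm].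
by rewrite sigma_algebra_id//; exact: sigma_algebra_measurable.
Qed.

(** For cylinders this is the product rule over the union of the two finite
    sets of indices; it passes to the generated sigma-algebras one side at a
    time. *)
Lemma block_indep J1 J2 A B : J1 `&` J2 = set0 ->
  <<s block J1 >> A -> <<s block J2 >> B -> P (A `&` B) = (P A * P B)%E.
Proof.
move=> J12 JA JB.
have sub J : <<s block J >> `<=` <<s cylinders J >>.
  by apply: sub_smallest2r => // C JC; exact: block_cylinders.
have mB := block_sigma_measurable JB.
apply: (@indep_sigma_l _ _ _ _ (cylinders J1)) => //.
- exact: cylinders_setI.
- exact: cylinders_measurable.
- move=> A' JA'; rewrite setIC muleC.
  apply: (@indep_sigma_l _ _ _ _ (cylinders J2)) => //.
  + exact: cylinders_setI.
  + exact: cylinders_measurable.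
  + exact: cylinders_measurable JA'.
  + by move=> B' JB'; rewrite setIC muleC; exact: cylinders_indep JA' JB'.
  + exact: sub.
- exact: sub.
Qed.

End Blocks.

Section Colours.
Context d (T : measurableType d) (R : realType) (P : probability T R).

Lemma mutually_independent_reindex (I I' : choiceType) (G : I -> set (set T))
    (e : I' -> I) (f : I -> I') (J : {fset I}) (A : I -> set T) :
  cancel e f -> mutually_independent P (G \o e) ->
  (forall i, i \in J -> e (f i) = i) -> (forall i, i \in J -> G i (A i)) ->
  P (\bigcap_(i in [set` J]) A i) = (\prod_(i <- J) P (A i))%E.
Proof.
move=> eK Gind fK GA.
have -> : J = [fset e x | x in [fset f i | i in J]]%fset.
  apply/fsetP => i; apply/idP/imfsetP => [iJ|[x /imfsetP[j/= jJ ->] ->]].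
    by exists (f i); [exact: in_imfset | rewrite fK].
  by rewrite fK.
rewrite big_imfset/=; last by move=> x y _ _; exact: can_inj eK _ _.
rewrite -(Gind _ (A \o e)); last first.
  by move=> x /imfsetP[j/= jJ ->]; rewrite fK//; exact: GA.
congr (P _); apply/seteqP; split=> x xA /= i.
  by move=> iJ; apply: xA => /=; exact: in_imfset.
by move=> /imfsetP[y/= yJ ->]; exact: xA.
Qed.

(** Group the events by colour. The intersection of the events of colour [k]
    still belongs to [H k], so the product rule holds between the colours; the
    product rule inside each colour does the rest. *)
Lemma mutually_independent_colour (I K : choiceType) (c : I -> K)
    (G : I -> set (set T)) (H : K -> set (set T)) :
  (forall i, G i `<=` H (c i)) -> (forall k, H k setT) ->
  (forall k, setI_closed (H k)) -> mutually_independent P H ->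
  (forall k (J : {fset I}) (A : I -> set T),
    (forall i, i \in J -> c i = k) -> (forall i, i \in J -> G i (A i)) ->
    P (\bigcap_(i in [set` J]) A i) = (\prod_(i <- J) P (A i))%E) ->
  mutually_independent P G.
Proof.
move=> GH HT HI Hind Gind J A GA.
pose Jk k := [fset i in J | c i == k]%fset.
pose B k := \bigcap_(i in [set` Jk k]) A i.
rewrite (partition_big_imfset _ c J)/=.
transitivity (P (\bigcap_(k in [set` [fset c x | x in J]%fset]) B k)).
  congr (P _); apply/seteqP; split=> x xA /=.
    move=> k _ i /=; rewrite !inE/= => /andP[iJ _]; exact: xA.
  move=> i /= iJ; apply: (xA (c i)); rewrite /= ?in_imfset//.
  by rewrite !inE/= iJ eqxx.
rewrite Hind; last first.
  move=> k _; rewrite /B bigcap_fset.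
  have : {in Jk k, forall i, H k (A i)}.
    by move=> i; rewrite !inE/= => /andP[/GA/GH + /eqP <-].
  move: (Jk k) => F FA; rewrite big_seq; elim/big_ind : _ => //.
  exact: HI.
apply: eq_bigr => k _; rewrite /B (Gind k); last 2 first.
- by move=> i; rewrite !inE/= => /andP[_ /eqP].
- by move=> i; rewrite !inE/= => /andP[/GA].
rewrite -big_fset_condE/=.
by apply: eq_bigl => i; rewrite ?inE.
Qed.

End Colours.

Section BlockMeasurable.
Context d (T : measurableType d) (I : choiceType) (G : I -> set (set T)).

Lemma block_measurable_fun (J : set I) i d' (T' : measurableType d') (X : T -> T') :
  J i -> rv_system X `<=` G i ->
  measurable_fun setT (X : g_sigma_algebraType (block G J) -> T').
Proof.
move=> Ji XG _ B mB; rewrite setTI; apply: sub_sigma_algebra.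
by exists i => //; apply: XG; exists B.
Qed.
End BlockMeasurable.

Section Decoupling.
Context d (T : measurableType d) (R : realType) (P : probability T R).
Context d1 d2 (T1 : measurableType d1) (T2 : measurableType d2).
Variables (X : T -> T1) (Y : T -> T2).
Hypothesis mX : measurable_fun setT X.
Hypothesis mY : measurable_fun setT Y.
Hypothesis XY : forall A B, measurable A -> measurable B ->
  P (X @^-1` A `&` Y @^-1` B) = (P (X @^-1` A) * P (Y @^-1` B))%E.

(** The joint law of [(X, Y)] is the product of the two laws, and the
    Fubini-Tonelli theorem turns it into an iterated integral: [Y] may be
    replaced by an independent copy. *)
Lemma ge0_integral_decouple (h : T1 * T2 -> \bar R) :
  measurable_fun setT h -> (forall z, 0 <= h z)%E ->
  (\int[P]_w h (X w, Y w) = \int[P]_w' \int[P]_w h (X w, Y w'))%E.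
Proof.
move=> mh h0.
pose X' : {mfun T >-> T1} := HB.pack X (isMeasurableFun.Build _ _ _ _ _ mX).
pose Y' : {mfun T >-> T2} := HB.pack Y (isMeasurableFun.Build _ _ _ _ _ mY).
have mZ : measurable_fun [set: T] (fun w => (X w, Y w)).
  exact: measurable_fun_pair.
pose Z : {mfun T >-> (T1 * T2)%type} :=
  HB.pack (fun w => (X w, Y w)) (isMeasurableFun.Build _ _ _ _ _ mZ).
have prodE A : measurable A ->
    (distribution P X' \x distribution P Y')%E A = distribution P Z A.
  apply: product_measure_unique => A1 B1 mA1 mB1.
  by rewrite /distribution /pushforward/=; exact: XY.
transitivity (\int[distribution P Z]_z h z)%E.
  by rewrite ge0_integral_distribution.
transitivity (\int[distribution P X' \x distribution P Y']_z h z)%E.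
  by apply: eq_measure_integral => A mA _; exact/esym/prodE.
rewrite fubini_tonelli2// ge0_integral_distribution//; last 2 first.
- exact: measurable_fun_fubini_tonelli_G.
- by move=> y; apply: integral_ge0.
apply: eq_integral => w' _ /=.
rewrite /fubini_G ge0_integral_distribution//.
exact: measurableT_comp.
Qed.

Lemma ge0_integral_indepM (f : T1 -> \bar R) (g : T2 -> \bar R) :
  measurable_fun setT f -> measurable_fun setT g ->
  (forall w, 0 <= f w)%E -> (forall w, 0 <= g w)%E ->
  (\int[P]_w (f (X w) * g (Y w)) =
   (\int[P]_w f (X w)) * (\int[P]_w g (Y w)))%E.
Proof.
move=> mf mg f0 g0.
rewrite (@ge0_integral_decouple (fun z => f z.1 * g z.2)%E); last 2 first.
- by apply: emeasurable_funM; exact: measurableT_comp.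
- by move=> z; rewrite mule_ge0.
under eq_integral.
  move=> w' _; rewrite /= ge0_integralZr//; last exact: measurableT_comp.
  over.
rewrite ge0_integralZl//; first exact: measurableT_comp.
exact: integral_ge0.
Qed.

Lemma measure_decouple (C : T1 * T2 -> bool) : measurable_fun setT C ->
  P [set w | C (X w, Y w)] = (\int[P]_w' P [set w | C (X w, Y w')])%E.
Proof.
move=> mC.
rewrite measure_bool; last by apply: (measurableT_comp mC); exact: measurable_fun_pair.
rewrite (@ge0_integral_decouple (fun z => (C z)%:R%:E))//; last first.
  exact: measurable_fun_bool_EFin.
apply: eq_integral => w' _; rewrite measure_bool//.
by apply: (measurableT_comp mC); exact: measurable_fun_pair.
Qed.

End Decoupling.

(** * Poisson terms, exponential and gamma laws *)

Section Density.
Context d (T : measurableType d) (R : realType).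
Variables (mu m : {measure set T -> \bar R}) (p : T -> R).
Hypothesis p0 : forall x, 0 <= p x.
Hypothesis mp : measurable_fun setT p.
Hypothesis mE : forall A, measurable A -> m A = (\int[mu]_(x in A) (p x)%:E)%E.

Import HBNNSimple.

Lemma integral_density_nnsfun (h : {nnsfun T >-> R}) :
  (\int[m]_x (h x)%:E = \int[mu]_x ((h x)%:E * (p x)%:E))%E.
Proof.
rewrite integralT_nnsfun sintegralE.
under [RHS]eq_integral => x _.
  rewrite fimfunE -fsumEFin// ge0_mule_fsuml; last first.
    by move=> r; rewrite EFinM; exact: nnfun_muleindic_ge0.
  over.
rewrite ge0_integral_fsum//; last 2 first.
- by move=> r; apply: emeasurable_funM; apply/measurable_EFinP => //; exact: measurable_funM.
- move=> r x _; rewrite mule_ge0//; last by rewrite lee_fin.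
  by rewrite EFinM; exact: nnfun_muleindic_ge0.
apply: eq_fsbigr => r; rewrite inE => -[z _ <-].
rewrite mE//.
under [RHS]eq_integral do rewrite EFinM -muleA.
rewrite ge0_integralZl//.
- congr (_ * _)%E; rewrite [LHS]integral_mkcond.
  apply: eq_integral => x _; rewrite patchE indicE.
  by case: ifP; rewrite ?mul1e ?mul0e.
- by apply: emeasurable_funM; apply/measurable_EFinP.
- by move=> x _; rewrite mule_ge0// lee_fin.
- by rewrite lee_fin.
Qed.

(** Monotone limit of the case of simple functions. *)
Lemma ge0_integral_density (f : T -> \bar R) :
  measurable_fun setT f -> (forall x, 0 <= f x)%E ->
  (\int[m]_x f x = \int[mu]_x (f x * (p x)%:E))%E.
Proof.
move=> mf f0.
pose g := nnsfun_approx measurableT mf.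
have gcvg x : EFin \o g ^~ x @ \oo --> f x by apply: cvg_nnsfun_approx.
have gnd x a b : (a <= b)%N -> ((g a x)%:E <= (g b x)%:E)%E.
  by move=> ab; rewrite lee_fin; exact/lefP/nd_nnsfun_approx.
transitivity (limn (fun n => \int[m]_x (g n x)%:E))%E.
  rewrite -monotone_convergence//.
  - by apply: eq_integral => x _; apply/esym/cvg_lim => //; exact: gcvg.
  - by move=> n; exact/measurable_EFinP.
  - by move=> n x _; rewrite lee_fin.
  - by move=> x _ a b ab; exact: gnd.
under eq_fun do rewrite integral_density_nnsfun.
rewrite -monotone_convergence//.
- apply: eq_integral => x _; apply/cvg_lim => //.
  by apply: cvgeZr => //; exact: gcvg.
- by move=> n; apply: emeasurable_funM; exact/measurable_EFinP.
- by move=> n x _; rewrite mule_ge0// lee_fin.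
- by move=> x _ a b ab; rewrite lee_wpmul2r ?lee_fin//; exact: gnd.
Qed.

End Density.

Section PoissonTerms.
Context (R : realType).
Implicit Types (x c : R) (m : nat).

(** Agrees with [poisson_pmf] for positive rates, but is smooth on the whole
    line, whereas [poisson_pmf] jumps to 1 at nonpositive rates. *)
Definition poisson_term m x : R := x ^+ m / m`!%:R * expR (- x).

(** Probability that a Poisson variable of mean [x] is less than [m]. *)
Definition poisson_cdf m x : R := \sum_(j < m) poisson_term j x.

Lemma poisson_term_ge0 m x : 0 <= x -> 0 <= poisson_term m x.
Proof. by move=> x0; rewrite !mulr_ge0 ?exprn_ge0 ?invr_ge0 ?expR_ge0. Qed.

Lemma is_derive_expRN x : is_derive x 1 (fun y => expR (- y)) (- expR (- x)).
Proof.
have -> : - expR (- x) = expR (- x) * -1 by rewrite mulrN1.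
apply: (@is_derive1_comp _ expR (fun y => - y)).
Qed.

Lemma is_derive_exp_fact m x :
  is_derive x 1 (fun y => y ^+ m.+1 / m.+1`!%:R) (x ^+ m / m`!%:R).
Proof.
have -> : (fun y : R => y ^+ m.+1 / m.+1`!%:R) = (m.+1`!%:R^-1 \*: (@id R) ^+ m.+1).
  by apply/funext => y; rewrite mulrC -[RHS]/(m.+1`!%:R^-1 * ((@id R ^+ m.+1) y)) exprfctE.
apply: is_derive_eq => /=.
rewrite /GRing.scale/= mulr1 factS natrM.
by field; rewrite nat1r !pnatr_eq0 -lt0n fact_gt0.
Qed.

(** The derivative of each term is a difference of consecutive terms, so the
    sum telescopes. *)
Lemma is_derive_poisson_cdf m x :
  is_derive x 1 (poisson_cdf m.+1) (- poisson_term m x).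
Proof.
elim: m => [|m IH].
  have -> : poisson_cdf 1 = (fun y => expR (- y)).
    by apply/funext => y; rewrite /poisson_cdf big_ord1 /poisson_term expr0 fact0 divr1 mul1r.
  rewrite /poisson_term expr0 fact0 divr1 mul1r; exact: is_derive_expRN.
have -> : poisson_cdf m.+2 = poisson_cdf m.+1 + (fun y => y ^+ m.+1 / m.+1`!%:R) * (fun y => expR (- y)).
  by apply/funext => y; rewrite /poisson_cdf big_ord_recr.
have := is_derive_exp_fact m x; have := is_derive_expRN x => d1 d2.
apply: is_derive_eq; rewrite /GRing.scale/= /poisson_term.
ring.
Qed.

(** The next term of the exponential series bounds [expR x] from below, so the
    term is at most [m.+1 / x]. *)
Lemma cvg_poisson_term m : poisson_term m x @[x --> +oo] --> (0 : R).
Proof.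
apply: (@squeeze_cvgr _ _ _ _ (fun=> 0) (fun x => m.+1%:R / x)).
- near=> x.
  have x0 : 0 < x by near: x; exact: nbhs_pinfty_gt.
  rewrite (poisson_term_ge0 m (ltW x0))/=.
  rewrite /poisson_term expRN ler_pdivrMr ?expR_gt0//.
  rewrite mulrAC ler_pdivlMr//.
  have := @expR_ge1Dxn R x m (ltW x0).
  rewrite factS natrM invfM => h.
  have -> : x ^+ m / m`!%:R * x = m.+1%:R * (x ^+ m.+1 * (m.+1%:R^-1 * m`!%:R^-1)).
    by rewrite exprSr; field; rewrite nat1r !pnatr_eq0 -lt0n fact_gt0.
  by rewrite ler_pM2l// (le_trans _ h)// lerDr.
- exact: cvg_cst.
- rewrite -[X in _ --> X](mulr0 m.+1%:R).
  apply: cvgMr; apply: (proj2 (@gtr0_cvgV0 R R (pinfty_nbhs R) _ id _)).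
    by near=> x; near: x; exact: nbhs_pinfty_gt.
  exact: cvg_id.
Unshelve. all: by end_near. Qed.

Lemma cvg_poisson_cdf m : poisson_cdf m x @[x --> +oo] --> (0 : R).
Proof.
elim: m => [|m IH].
  rewrite (_ : poisson_cdf 0 = cst 0); first exact: cvg_cst.
  by apply/funext => x; rewrite /poisson_cdf big_ord0.
rewrite (_ : poisson_cdf m.+1 = poisson_cdf m \+ poisson_term m); last first.
  by apply/funext => x; rewrite /poisson_cdf big_ord_recr.
by rewrite -[X in _ --> X]addr0; apply: cvgD => //; exact: cvg_poisson_term.
Qed.

Lemma poisson_cdf_0 m : poisson_cdf m.+1 0 = 1.
Proof.
rewrite /poisson_cdf big_ord_recl/= big1 ?addr0.
  by rewrite /poisson_term expr0 fact0 divr1 mul1r oppr0 expR0.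
by move=> i _; rewrite /poisson_term expr0n/= !mul0r.
Qed.

Lemma poisson_cdfS m x : poisson_cdf m.+1 x = poisson_cdf m x + poisson_term m x.
Proof. by rewrite /poisson_cdf big_ord_recr. Qed.

Lemma derivable_continuous (f : R -> R) :
  (forall x, derivable f x 1) -> continuous f.
Proof. by move=> df x; apply: differentiable_continuous; apply/derivable1_diffP. Qed.

Lemma continuous_poisson_cdf m : continuous (poisson_cdf m.+1).
Proof.
apply: derivable_continuous => x; have := is_derive_poisson_cdf m x => ?.
exact: ex_derive.
Qed.

Lemma continuous_poisson_term m : continuous (poisson_term m).
Proof.
case: m => [|m].
  apply: derivable_continuous => x; have := is_derive_expRN x.
  rewrite (_ : poisson_term 0 = (fun y => expR (- y))).
    by move=> ?; exact: ex_derive.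
  by apply/funext => y; rewrite /poisson_term expr0 fact0 divr1 mul1r.
rewrite (_ : poisson_term m.+1 = poisson_cdf m.+2 - poisson_cdf m.+1).
  by move=> x; apply: cvgB; exact: continuous_poisson_cdf.
by apply/funext => x; rewrite !fctE/= (poisson_cdfS m.+1) addrAC subrr add0r.
Qed.

(** By [is_derive_poisson_cdf], [- poisson_cdf m.+1 (c * x)] is an
    antiderivative. *)
Lemma integral_gamma m c : 0 < c ->
  (\int[lebesgue_measure]_(x in `[0%R, +oo[) (c * poisson_term m (c * x))%:E
   = 1%:E)%E.
Proof.
move=> c0.
have dM x : is_derive x 1 (fun y => c * y) c.
  have -> : (fun y => c * y) = (c \*: (@id R)) by [].
  by apply: is_derive_eq; rewrite /GRing.scale/= mulr1.
have dF x : is_derive x 1 (fun y => - poisson_cdf m.+1 (c * y))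
    (c * poisson_term m (c * x)).
  have d1 := @is_derive_poisson_cdf m (c * x).
  have := @is_derive1_comp _ (poisson_cdf m.+1) (fun y => c * y) x _ _ d1 (dM x) => d2.
  have -> : (fun y => - poisson_cdf m.+1 (c * y)) = - (poisson_cdf m.+1 \o (fun y => c * y)) by [].
  by apply: is_derive_eq; ring.
rewrite (@ge0_continuous_FTC2y _ _ (fun y => - poisson_cdf m.+1 (c * y)) 0 0).
- by rewrite mulr0 poisson_cdf_0 sub0e EFinN oppeK.
- by move=> x x0; rewrite mulr_ge0 ?poisson_term_ge0 ?mulr_ge0// ltW.
- apply: continuous_subspaceT => x.
  apply: cvgMr; apply: (@continuous_comp _ _ _ (fun y => c * y) (poisson_term m)).
    by apply: cvgMr; exact: cvg_id.
  exact: continuous_poisson_term.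
- rewrite -[X in _ --> X]oppr0; apply: cvgN.
  apply: (@cvg_comp _ _ _ (fun y => c * y) (poisson_cdf m.+1) _ (pinfty_nbhs R)).
    exact: gt0_cvgMry.
  exact: cvg_poisson_cdf.
- by move=> x _; have := dF x => ?; exact: ex_derive.
- apply: cvg_at_right_filter.
  have : continuous (fun y => - poisson_cdf m.+1 (c * y)).
    by apply: derivable_continuous => x; have := dF x => ?; exact: ex_derive.
  exact.
- by move=> x _; rewrite derive1E; have := dF x => ?; exact: derive_val.
Qed.

(** Density of one more exponential variable against the distribution function
    of a sum of [m]. As [expR (- c * x) * expR (- (c * (v - x)))] does not
    depend on [x], the integrand is a polynomial plus an exponential, and has
    an explicit antiderivative. *)
Lemma integral_gamma_convolution m c v : 0 < c -> 0 < v ->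
  (\int[lebesgue_measure]_(x in `[0%R, v])
     ((1 - poisson_cdf m (c * (v - x))) * (c * expR (- c * x)))%:E
   = (1 - poisson_cdf m.+1 (c * v))%:E)%E.
Proof.
move=> c0 v0.
have dM x : is_derive x 1 (fun y => c * y) c.
  have -> : (fun y => c * y) = (c \*: (@id R)) by [].
  by apply: is_derive_eq; rewrite /GRing.scale/= mulr1.
have dE x : is_derive x 1 (fun y => expR (- (c * y))) (- (c * expR (- (c * x)))).
  have d1 := is_derive_expRN (c * x).
  have := @is_derive1_comp _ (fun y => expR (- y)) (fun y => c * y) x _ _ d1 (dM x) => d2.
  by apply: is_derive_eq; ring.
have dV x : is_derive x 1 (fun y => c * (v - y)) (- c).
  have -> : (fun y => c * (v - y)) = (c \*: (cst v - (@id R))) by [].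
  by apply: is_derive_eq; rewrite /GRing.scale/=; ring.
pose Q (m : nat) (x : R) : R := \sum_(j < m) (c * (v - x)) ^+ j.+1 / j.+1`!%:R.
have dQ k x : is_derive x 1 (Q k) (- (c * \sum_(j < k) (c * (v - x)) ^+ j / j`!%:R)).
  elim: k => [|k IH].
    rewrite (_ : Q 0%N = cst 0); last by apply/funext => y; rewrite /Q big_ord0.
    by rewrite big_ord0 mulr0 oppr0; exact: is_derive_cst.
  have -> : Q k.+1 = Q k + ((fun y => y ^+ k.+1 / k.+1`!%:R) \o (fun y => c * (v - y))).
    by apply/funext => y; rewrite /Q big_ord_recr.
  have := @is_derive1_comp _ _ _ x _ _ (is_derive_exp_fact k (c * (v - x))) (dV x) => d2.
  apply: is_derive_eq; rewrite big_ord_recr/=; ring.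
pose F x := expR (- (c * v)) * Q m x - expR (- (c * x)).
have dF x : is_derive x 1 F
    ((1 - poisson_cdf m (c * (v - x))) * (c * expR (- c * x))).
  have -> : F = (expR (- (c * v)) \*: Q m) - (fun y => expR (- (c * y))) by [].
  have := dE x; have := dQ m x => ? ?.
  apply: is_derive_eq; rewrite /GRing.scale/= /poisson_cdf.
  rewrite [expR (- (c * v))](_ : _ = expR (- (c * (v - x))) * expR (- c * x)); last first.
    by rewrite -expRD; congr expR; ring.
  rewrite /poisson_term -mulr_suml mulNr; ring.
have cF : continuous F.
  by apply: derivable_continuous => x; have := dF x => ?; exact: ex_derive.
rewrite (@continuous_FTC2 _ _ F)//.
- rewrite -EFinB; congr EFin; rewrite /F.
  have -> : Q m v = 0 by apply: big1 => i _; rewrite subrr mulr0 expr0n/= mul0r.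
  have -> : poisson_cdf m.+1 (c * v) = expR (- (c * v)) * (1 + Q m 0).
    rewrite /poisson_cdf big_ord_recl/= mulrDr mulr1.
    congr +%R; first by rewrite /poisson_term expr0 fact0 divr1 mul1r.
    rewrite /Q mulr_sumr; apply: eq_bigr => i _.
    by rewrite /poisson_term subr0 mulrC.
  rewrite !mulr0 oppr0 expR0; ring.
- apply: continuous_subspaceT; apply: derivable_continuous => x.
  have dc : is_derive x 1 (poisson_cdf m \o (fun y => c * (v - y))) ('D_1 (poisson_cdf m \o (fun y => c * (v - y))) x).
    apply: derivableP; case: (m) => [|k].
      rewrite (_ : _ \o _ = cst 0)//.
      by apply/funext => y; rewrite /= /poisson_cdf big_ord0.
    have := @is_derive1_comp _ _ _ x _ _ (@is_derive_poisson_cdf k (c * (v - x))) (dV x) => d2.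
    exact: ex_derive.
  have := dE x => d1.
  have -> : (fun y => (1 - poisson_cdf m (c * (v - y))) * (c * expR (- c * y))) =
    (cst 1 - (poisson_cdf m \o (fun y => c * (v - y)))) * (c \*: (fun y => expR (- (c * y)))).
    by apply/funext => y; rewrite !fctE/= mulNr.
  exact: ex_derive.
- split.
  + by move=> x _; have := dF x => ?; exact: ex_derive.
  + exact/cvg_at_right_filter/cF.
  + exact/cvg_at_left_filter/cF.
- by move=> x _; rewrite derive1E; have := dF x => ?; exact: derive_val.
Qed.

End PoissonTerms.

Section ExponentialLaw.
Context d (T : measurableType d) (R : realType) (P : probability T R).
Variables (X : {RV P >-> R}) (c : R).
Hypothesis c_gt0 : 0 < c.
Hypothesis X_law : forall A, measurable A ->
  distribution P X A = exponential_prob c A.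

Lemma ge0_integral_exponential (g : R -> R) :
  measurable_fun setT g -> (forall x, 0 <= g x) ->
  (\int[P]_w (g (X w))%:E =
   \int[lebesgue_measure]_(x in `[0%R, +oo[) (g x * (c * expR (- c * x)))%:E)%E.
Proof.
move=> mg g0.
have mX : measurable_fun setT (X : T -> measurableTypeR R).
  exact: (measurable_funPT X).
pose X' : {mfun T >-> measurableTypeR R} :=
  HB.pack (X : T -> measurableTypeR R) (isMeasurableFun.Build _ _ _ _ _ mX).
transitivity (\int[distribution P X']_x (g x)%:E)%E.
  rewrite (ge0_integral_distribution X' (f := fun x => (g x)%:E))//.
  exact/measurable_EFinP.
transitivity (\int[lebesgue_measure]_x ((g x)%:E * (exponential_pdf c x)%:E))%E.
  apply: (@ge0_integral_density _ _ R lebesgue_measure (distribution P X')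
    (exponential_pdf c)) => //.
  - by move=> x; apply: exponential_pdf_ge0; exact: ltW.
  - exact: measurable_exponential_pdf.
  - exact/measurable_EFinP.
rewrite [RHS]integral_mkcond; apply: eq_integral => x _.
rewrite /exponential_pdf !patchE; case: ifPn => _; first by rewrite EFinM.
by rewrite mule0.
Qed.

Lemma poisson_pmfE (r : R) m : 0 < r -> poisson_pmf r m = poisson_term m r.
Proof. by move=> r0; rewrite /poisson_pmf r0. Qed.

(** The endpoint 0, where [poisson_pmf (lam * x)] differs from the smooth
    [poisson_term], has measure zero. *)
Lemma integral_itvcy_open (f g : R -> R) : measurable_fun setT f -> measurable_fun setT g ->
  (forall x, 0 < x -> f x = g x) ->
  (\int[lebesgue_measure]_(x in `[0%R, +oo[) (f x)%:E =
   \int[lebesgue_measure]_(x in `[0%R, +oo[) (g x)%:E)%E.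
Proof.
move=> mf mg fg; rewrite -!integral_itv_obnd_cbnd; last 2 first.
- exact/measurable_EFinP/measurable_funTS.
- exact/measurable_EFinP/measurable_funTS.
by apply: eq_integral => x; rewrite inE/= in_itv/= andbT => x0; rewrite fg.
Qed.

Lemma measurable_poisson_term m : measurable_fun setT (@poisson_term R m).
Proof. by apply: continuous_measurable_fun; exact: continuous_poisson_term. Qed.

Lemma measurable_expRM : measurable_fun setT (fun x => c * expR (- c * x)).
Proof.
by apply: measurable_funM => //; apply: measurableT_comp.

Qed.

(** A Poisson count over an exponential time is geometric: the product of the
    two densities is a multiple of a gamma density of rate [lam + c]. *)
Lemma integral_poisson_mixture (lam : R) m : 0 < lam ->
  (\int[P]_w (poisson_pmf (lam * X w) m)%:E =
   (c / (lam + c) * (lam / (lam + c)) ^+ m)%:E)%E.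
Proof.
move=> lam0.
have lc0 : 0 < lam + c by exact: addr_gt0.
rewrite (@ge0_integral_exponential (fun x => poisson_pmf (lam * x) m)); last 2 first.
- apply: (@measurableT_comp _ _ _ _ _ _ (@poisson_pmf R ^~ m)) => //.
  exact: measurable_poisson_pmf.
- by move=> x; exact: poisson_pmf_ge0.
pose k := c / (lam + c) * (lam / (lam + c)) ^+ m.
rewrite (@integral_itvcy_open _ (fun x => k * ((lam + c) * poisson_term m ((lam + c) * x)))).
- under eq_integral do rewrite EFinM.
  rewrite ge0_integralZl//.
  + by rewrite integral_gamma// mule1.
  + apply/measurable_EFinP/measurable_funTS; apply: measurable_funM => //.
    apply: measurableT_comp; first exact: measurable_poisson_term.
    exact: measurable_funM.
  + move=> x /=; rewrite in_itv/= andbT => x0; rewrite lee_fin mulr_ge0//.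
      exact: ltW.
    by apply: poisson_term_ge0; rewrite mulr_ge0// ltW.
  + by rewrite lee_fin mulr_ge0 ?exprn_ge0 ?divr_ge0// ltW.
- apply: measurable_funM; last exact: measurable_expRM.
  apply: (@measurableT_comp _ _ _ _ _ _ (@poisson_pmf R ^~ m)) => //.
  exact: measurable_poisson_pmf.
- do 2 apply: measurable_funM => //.
  apply: measurableT_comp; first exact: measurable_poisson_term.
  exact: measurable_funM.
- move=> x x0; rewrite poisson_pmfE ?mulr_gt0// /poisson_term /k.
  rewrite [expR (- ((lam + c) * x))](_ : _ = expR (- (lam * x)) * expR (- c * x)); last first.
    by rewrite -expRD; congr expR; ring.
  rewrite !exprMn exprVn.
  field; rewrite pnatr_eq0 -lt0n fact_gt0/= expf_neq0//= gt_eqF//.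
Qed.

Lemma integral_abs_exponential : (\int[P]_w (`|X w|)%:E = (c^-1)%:E)%E.
Proof.
rewrite (@ge0_integral_exponential (fun x => `|x|)); last 2 first.
- exact: measurableT_comp.
- by move=> x.
rewrite (@integral_itvcy_open _ (fun x => c^-1 * (c * poisson_term 1 (c * x)))).
- under eq_integral do rewrite EFinM.
  rewrite ge0_integralZl//.
  + by rewrite integral_gamma// mule1.
  + apply/measurable_EFinP/measurable_funTS; apply: measurable_funM => //.
    apply: measurableT_comp; first exact: measurable_poisson_term.
    exact: measurable_funM.
  + move=> x /=; rewrite in_itv/= andbT => x0; rewrite lee_fin mulr_ge0//.
      exact: ltW.
    by apply: poisson_term_ge0; rewrite mulr_ge0// ltW.
  + by rewrite lee_fin invr_ge0 ltW.
- by apply: measurable_funM; [exact: normr_measurable | exact: measurable_expRM].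
- do 2 apply: measurable_funM => //.
  apply: measurableT_comp; first exact: measurable_poisson_term.
  exact: measurable_funM.
- move=> x x0; rewrite gtr0_norm// /poisson_term factS fact0 divr1 expr1 mulNr.
  by field; rewrite gt_eqF.
Qed.

(** Probability that the sum of [m] independent exponential variables of rate
    [c] is less than [v]. For [v > 0] this is the probability that a Poisson
    variable of mean [c * v] is at least [m]. *)
Definition gamma_cdf m (v : R) : R :=
  if 0 < v then 1 - poisson_cdf m (c * v) else 0.

Lemma measurable_poisson_cdf m : measurable_fun setT (@poisson_cdf R m).
Proof.
by apply: measurable_sum => j; exact: measurable_poisson_term.
Qed.

Lemma measurable_gamma_cdf m : measurable_fun setT (gamma_cdf m).
Proof.
apply: measurable_fun_if => //.
- exact: measurable_fun_ltr.
- apply: measurable_funB => //; apply: measurable_funTS.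
  by apply: measurableT_comp; [exact: measurable_poisson_cdf | exact: measurable_funM].
Qed.

Lemma integral_gamma_cdf m v : (forall x, 0 <= gamma_cdf m x) ->
  (\int[P]_w (gamma_cdf m (v - X w))%:E = (gamma_cdf m.+1 v)%:E)%E.
Proof.
move=> G0.
have mG : measurable_fun setT (fun x : R => gamma_cdf m (v - x)).
  by apply: measurableT_comp; [exact: measurable_gamma_cdf | exact: measurable_funB].
rewrite (@ge0_integral_exponential (fun x => gamma_cdf m (v - x)))//.
rewrite {2}/gamma_cdf; case: ifPn => [v0|]; last first.
  rewrite -leNgt => v0; rewrite integral0_eq// => x; rewrite /= in_itv/= andbT => x0.
  by rewrite /gamma_cdf subr_gt0 ltNge (le_trans v0 x0)/= mul0r.
rewrite -(integral_gamma_convolution m c_gt0 v0).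
have mh : measurable_fun setT
    (fun x : R => (1 - poisson_cdf m (c * (v - x))) * (c * expR (- c * x))).
  apply: measurable_funM; last exact: measurable_expRM.
  apply: measurable_funB => //; apply: measurableT_comp.
    exact: measurable_poisson_cdf.
  by apply: measurable_funM => //; exact: measurable_funB.
rewrite -integral_itv_bndo_bndc; last exact/measurable_EFinP/measurable_funTS.
rewrite [LHS]integral_mkcond [RHS]integral_mkcond.
apply: eq_integral => x _; rewrite !patchE.
rewrite !mem_setE !in_itv/= andbT.
rewrite /gamma_cdf subr_gt0.
by case: (ltP x v) => xv; case: (leP 0 x) => x0 //=; rewrite mul0r.
Qed.

End ExponentialLaw.

(** * Series of renewal theory *)

Lemma nneseries_EFin (R : realType) (u : nat -> R) (l : R) :
  \sum_(k < m) u k @[m --> \oo] --> l -> (\sum_(k <oo) (u k)%:E = l%:E)%E.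
Proof.
move=> ul; apply/cvg_lim => //.
rewrite (_ : (fun m => _) = EFin \o (fun m => \sum_(k < m) u k)); last first.
  by apply/funext => m; rewrite /= sumEFin big_mkord.
by apply: cvg_EFin => //; near=> m.
Unshelve. all: by end_near. Qed.

Lemma nneseries_prefix (R : realType) (f : nat -> \bar R) (Q : pred nat) m :
  (forall k, (0 <= f k)%E) -> (forall k, Q k = (k < m)%N) ->
  (\sum_(k <oo | Q k) f k = \sum_(k < m) f k)%E.
Proof.
move=> f0 Qm; rewrite (nneseries_split_cond 0 m)//.
rewrite add0n [X in (_ + X)%E]eseries0 ?adde0; last first.
  by move=> k mk; rewrite Qm ltnNge mk.
rewrite big_mkord; apply: eq_bigl => k; rewrite Qm; exact: ltn_ord.
Qed.

Section GeometricRenewal.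
Context (R : realType) (a b : R).
Hypothesis bE : b = 1 - a.
(* [hit l m] stands for the probability that [l] independent geometric variables
   add up to [m]. *)
Variable hit : nat -> nat -> R.
Hypothesis hit0 : forall m, hit 0 m = (m == 0)%N%:R.
Hypothesis hitS : forall l m, hit l.+1 m = \sum_(i < m) hit l i * (a * b ^+ (m - i).-1).

Lemma renewal_eq0 l m : (m < l)%N -> hit l m = 0.
Proof.
elim: l m => // l IH m ml; rewrite hitS big1// => i _.
by rewrite IH ?mul0r//; have := ltn_ord i; lia.
Qed.

Lemma geometric_mass m : \sum_(i < m) a * b ^+ i = 1 - b ^+ m.
Proof.
elim: m => [|m IH]; first by rewrite big_ord0 expr0 subrr.
by rewrite big_ord_recr/= IH exprS bE; ring.
Qed.

(** Partial sums of geometric variables hit every positive integer with the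
    same probability [a]. Strong induction on [m], after a decomposition
    according to the last variable. *)
Lemma renewal_density K m : (m < K)%N ->
  \sum_(l < K) hit l m = if m is 0%N then 1 else a.
Proof.
elim/ltn_ind: m K => m IH [//|K] mK.
rewrite big_ord_recl/= hit0.
under eq_bigr do rewrite hitS.
rewrite exchange_big/=.
under eq_bigr do rewrite -mulr_suml.
case: m IH mK => [|m] IH mK; first by rewrite big_ord0 addr0.
rewrite add0r big_ord_recl/= (IH 0%N)//; last by lia.
rewrite mul1r/=.
transitivity (a * b ^+ m + a * \sum_(i < m) (a * b ^+ i)).
  congr (_ + _); rewrite mulr_sumr (reindex_inj rev_ord_inj)/=.
  apply: eq_bigr => i _; rewrite (IH (bump 0 (m - i.+1)))//; last 2 first.
  - by rewrite /bump/=; have := ltn_ord i; lia.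
  - by rewrite /bump/=; have := ltn_ord i; lia.
  rewrite /bump /= add1n; congr (_ * (_ * _ ^+ _)).
  by have := ltn_ord i; lia.
rewrite geometric_mass; ring.
Qed.

End GeometricRenewal.

Section RenewalSeries.
Context (R : realType) (p q : R).
Hypotheses (p_gt0 : 0 < p) (q_gt0 : 0 < q) (pq1 : p + q = 1).
(* [r k l] stands for the probability that observation [k] sees [l] attacks,
   [below k l] for the probability that it sees at most [l]. *)
Variables (r below : nat -> nat -> R).
Hypothesis r_ge0 : forall k l, 0 <= r k l.
Hypothesis below0 : forall l, below 0 l = 1.
Hypothesis belowE : forall k l, below k l = \sum_(i < l.+1) r k i.
Hypothesis belowS : forall k l,
  below k l = below k.+1 l + \sum_(i < l.+1) r k i * q ^+ (l - i).+1.

Lemma q_le1 : q <= 1. Proof. by rewrite -pq1 lerDr ltW. Qed.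

Lemma below_ge0 k l : 0 <= below k l.
Proof. by rewrite belowE; apply: sumr_ge0. Qed.

(** Whatever the number of attacks seen, if it is at most [l], then the next
    observation sees more than [l] with probability at least [q ^+ l.+1]. *)
Lemma below_decay k l : below k l <= (1 - q ^+ l.+1) ^+ k.
Proof.
have ql1 : q ^+ l.+1 <= 1 by rewrite exprn_ile1 ?q_le1// ltW.
elim: k => [|k IH]; first by rewrite below0 expr0.
rewrite exprS; apply: (@le_trans _ _ ((1 - q ^+ l.+1) * below k l)); last first.
  by rewrite ler_wpM2l// subr_ge0.
have := belowS k l.
have : q ^+ l.+1 * below k l <= \sum_(i < l.+1) r k i * q ^+ (l - i).+1.
  rewrite belowE mulr_sumr; apply: ler_sum => i _; rewrite mulrC ler_wpM2l//.
  by apply: ler_wiXn2l; rewrite ?q_le1 ?(ltW q_gt0)//; lia.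
rewrite mulrBl mul1r; lra.
Qed.

Lemma below_cvg0 l : below k l @[k --> \oo] --> (0 : R).
Proof.
apply: (@squeeze_cvgr _ _ _ _ (fun=> 0) (fun k => (1 - q ^+ l.+1) ^+ k)).
- by apply: nearW => k; rewrite below_ge0 below_decay.
- exact: cvg_cst.
- apply: cvg_expr; rewrite ger0_norm; last first.
    by rewrite subr_ge0 exprn_ile1 ?q_le1// ltW.
  by rewrite ltrBlDr ltrDl exprn_gt0.
Qed.

(** By [belowS] the sum over the observations telescopes. *)
Lemma partial_visits n l :
  \sum_(i < l.+1) (\sum_(k < n) r k i) * q ^+ (l - i).+1 = 1 - below n l.
Proof.
under eq_bigr do rewrite mulr_suml.
rewrite exchange_big/=; elim: n => [|n IH]; first by rewrite big_ord0 below0 subrr.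
by rewrite big_ord_recr/= IH {1}belowS opprD addrA subrK.
Qed.

Lemma partial_visits0 n : q * \sum_(k < n) r k 0 = 1 - below n 0.
Proof. by rewrite -partial_visits big_ord1 subnn expr1 mulrC. Qed.

Lemma partial_visitsS n l :
  q * \sum_(k < n) r k l.+1 = (1 - below n l.+1) - q * (1 - below n l).
Proof.
rewrite -!partial_visits big_ord_recr/= subnn expr1.
rewrite [X in _ = X + _ - _](_ : _ =
  q * \sum_(i < l.+1) (\sum_(k < n) r k i) * q ^+ (l - i).+1).
  by rewrite addrAC addrN add0r mulrC.
rewrite mulr_sumr; apply: eq_bigr => i _; have il : (i <= l)%N by rewrite -ltnS.
by rewrite subSn// [q ^+ _.+2]exprS mulrCA.
Qed.

(** The expected number of observations that see exactly [l] attacks. *)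
Definition visits l : R := if l is 0%N then q^-1 else p / q.

Lemma nneseries_visits l : (\sum_(k <oo) (r k l)%:E = (visits l)%:E)%E.
Proof.
have q0 : q != 0 by rewrite gt_eqF.
have cvg1 i : 1 - below m i @[m --> \oo] --> (1 : R).
  by rewrite -[X in _ --> X]subr0; apply: cvgB; [exact: cvg_cst | exact: below_cvg0].
apply: nneseries_EFin; case: l => [|l] /=.
  rewrite (_ : (fun m => _) = (fun m => q^-1 * (1 - below m 0))); last first.
    by apply/funext => m; rewrite -partial_visits0 mulKf.
  by rewrite -[X in _ --> X]mulr1; apply: cvgMr; exact: cvg1.
rewrite (_ : (fun m => _) =
  (fun m => q^-1 * ((1 - below m l.+1) - q * (1 - below m l)))); last first.
  by apply/funext => m; rewrite -partial_visitsS mulKf.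
rewrite [p / q](_ : _ = q^-1 * (1 - q * 1)); last first.
  by rewrite mulr1 -[in RHS]pq1 addrK mulrC.
by apply: cvgMr; apply: cvgB; [exact: cvg1 | apply: cvgMr; exact: cvg1].
Qed.

(* [f i] stands for the probability that the first [i] attacks are calm. *)
Variables (f : nat -> R) (K : nat).
Hypotheses (f0 : f 0 = 1) (f_ge0 : forall l, 0 <= f l).
Hypothesis f_eq0 : forall l, (K < l)%N -> f l = 0.

(** The probability that the last observation before attack [l] sees [i] calm
    attacks, summed over [i]. *)
Definition passes l : R := \sum_(i < l.+1) visits i * q ^+ (l - i).+1 * f i.

Lemma passes0 : passes 0 = 1.
Proof. by rewrite /passes big_ord1 /= expr1 f0 mulr1 mulVf// gt_eqF. Qed.

Lemma passesS l : passes l.+1 = q * passes l + p * f l.+1.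
Proof.
rewrite /passes big_ord_recr/= subnn expr1 divfK ?gt_eqF//; congr (_ + _).
rewrite mulr_sumr; apply: eq_bigr => i _; have il : (i <= l)%N by rewrite -ltnS.
by rewrite subSn// [q ^+ _.+2]exprS; ring.
Qed.

Lemma partial_passes m :
  p * \sum_(l < m) passes l = 1 - passes m + p * \sum_(i < m) f i.+1.
Proof.
elim: m => [|m IH]; first by rewrite !big_ord0 passes0; ring.
rewrite !big_ord_recr/= !mulrDr IH passesS.
have -> : q = 1 - p by rewrite -pq1 addrAC subrr add0r.
ring.
Qed.

Lemma passes_tail k : passes (k + K) = q ^+ k * passes K.
Proof.
elim: k => [|k IH]; first by rewrite add0n expr0 mul1r.
by rewrite addSn passesS IH f_eq0 ?mulr0 ?addr0 ?exprS ?mulrA//; lia.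
Qed.

(** Summing [passesS] over all [l] gives a linear equation for the total,
    because [passes] decays geometrically once [f] vanishes. *)
Lemma nneseries_passes :
  (\sum_(l <oo) \sum_(k <oo) \sum_(i < l.+1) (r k i * q ^+ (l - i).+1 * f i)%:E =
   (q / p + \sum_(i < K.+1) f i)%:E)%E.
Proof.
have p0 : p != 0 by rewrite gt_eqF.
transitivity (\sum_(l <oo) (passes l)%:E)%E.
  apply: eq_eseriesr => l _; rewrite nneseries_sum; last first.
    by move=> i k _; rewrite lee_fin !mulr_ge0// ?exprn_ge0// ltW.
  rewrite /passes -sumEFin; apply: eq_bigr => i _.
  under eq_eseriesr do rewrite -mulrA mulrC EFinM.
  rewrite nneseriesZl; last by move=> k _; rewrite lee_fin.
  by rewrite nneseries_visits -EFinM mulrC mulrA.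
have -> : q / p + \sum_(i < K.+1) f i =
    p^-1 * (1 - 0 * passes K) + \sum_(i < K) f i.+1.
  rewrite big_ord_recl/= f0 mul0r subr0 mulr1 addrA; congr (_ + _).
  by rewrite -[q](addKr p) pq1; field.
apply: nneseries_EFin; rewrite -(cvg_shiftn K).
rewrite (_ : (fun m => _) =
    fun k => p^-1 * (1 - q ^+ k * passes K) + \sum_(i < K) f i.+1); last first.
  apply/funext => k; apply: (mulfI p0).
  rewrite mulrDr mulVKf// partial_passes passes_tail; congr (_ + _ * _).
  rewrite addnC big_split_ord/= [X in _ + X]big1 ?addr0//.
  by move=> i _; rewrite f_eq0//; lia.
apply: cvgD; last exact: cvg_cst.
apply: cvgMr; apply: cvgB; first exact: cvg_cst.
apply: cvgMl; apply: cvg_expr; rewrite ger0_norm ?(ltW q_gt0)//.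
by rewrite -pq1 ltrDr.
Qed.

End RenewalSeries.

(** * The sources of randomness of the model *)

Section Sources.
Context d (T : measurableType d) (R : realType) (P : probability T R).
Variables (t : nat -> {RV P >-> R}) (n : nat -> {RV P >-> nat})
  (w : nat -> nat -> {RV P >-> R}) (delta : nat -> {RV P >-> R}).

(** The attack times form one source: unlike the other families, they are not
    independent of each other. *)
Inductive source := Times | Size of nat | Weight of nat & nat | Gap of nat.

Definition source_code (s : source) : (unit + nat + (nat * nat) + nat)%type :=
  match s with
  | Times => inl (inl (inl tt))
  | Size k => inl (inl (inr k))
  | Weight k j => inl (inr (k, j))
  | Gap k => inr k
  end.

Definition source_decode (c : unit + nat + (nat * nat) + nat) : source :=
  match c with
  | inl (inl (inl _)) => Times
  | inl (inl (inr k)) => Size k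
  | inl (inr kj) => Weight kj.1 kj.2
  | inr k => Gap k
  end.

Lemma source_codeK : cancel source_code source_decode.
Proof. by case. Qed.

HB.instance Definition _ := Choice.copy source (can_type source_codeK).

Definition source_sigma (s : source) : set (set T) :=
  match s with
  | Times => sigma_family t
  | Size k => rv_system (n k)
  | Weight k j => rv_system (w k j)
  | Gap k => rv_system (delta k)
  end.

(** The colours are the positions of the four families in [independent4]. *)
Definition source_family (s : source) : 'I_4 :=
  match s with
  | Times => inord 0 | Size _ => inord 1 | Weight _ _ => inord 2
  | Gap _ => inord 3
  end.

Lemma rv_systemT d' (T' : measurableType d') (X : T -> T') : rv_system X setT.
Proof. by exists setT; rewrite ?preimage_setT. Qed.

Lemma rv_systemI d' (T' : measurableType d') (X : T -> T') :
  setI_closed (rv_system X).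
Proof.
move=> _ _ [A mA <-] [B mB <-]; exists (A `&` B) => //; exact: measurableI.
Qed.

Lemma sigma_familyT (I : Type) d' (T' : measurableType d') (X : I -> T -> T') :
  sigma_family X setT.
Proof. by rewrite -setC0; apply: sigma_algebraC; exact: sigma_algebra0. Qed.

Lemma sigma_familyI (I : Type) d' (T' : measurableType d') (X : I -> T -> T') :
  setI_closed (sigma_family X).
Proof.
move=> A B; pose G := \bigcup_i rv_system (X i).
exact: (@measurableI _ (g_sigma_algebraType G)).
Qed.

Lemma rv_system_family (I : Type) d' (T' : measurableType d') (X : I -> T -> T') i :
  rv_system (X i) `<=` sigma_family X.
Proof. by move=> A XA; apply: sub_sigma_algebra; exists i. Qed.

Lemma source_sigmaT s : source_sigma s setT.
Proof. by case: s => *; [exact: sigma_familyT|exact: rv_systemT..]. Qed.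

Lemma source_sigmaI s : setI_closed (source_sigma s).
Proof. by case: s => *; [exact: sigma_familyI|exact: rv_systemI..]. Qed.

Lemma rv_system_measurable d' (T' : measurableType d') (X : {RV P >-> T'}) A :
  rv_system X A -> measurable A.
Proof. by move=> [B mB <-]; rewrite -[X in measurable X]setTI; exact: measurable_funPT. Qed.

Lemma source_sigma_measurable s A : source_sigma s A -> measurable A.
Proof.
case: s => [|k|k j|k]/=; [|exact: rv_system_measurable..].
move=> tA; have : <<s @measurable _ T >> A.
  by apply: sub_smallest2r tA => // B [i _ /rv_system_measurable].
by rewrite sigma_algebra_id//; exact: sigma_algebra_measurable.
Qed.

Hypothesis n_indep : independent_rvs P n.
Hypothesis w_indep : independent_rvs P (fun kj : nat * nat => w kj.1 kj.2).
Hypothesis delta_indep : independent_rvs P delta.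
Hypothesis families : independent4 P (sigma_family t) (sigma_family n)
      (sigma_family (fun kj : nat * nat => w kj.1 kj.2)) (sigma_family delta).

Lemma sources_independent : mutually_independent P source_sigma.
Proof.
pose H (i : 'I_4) := nth set0 [:: sigma_family t; sigma_family n;
  sigma_family (fun kj : nat * nat => w kj.1 kj.2); sigma_family delta] i.
have HE : [/\ H (inord 0) = sigma_family t, H (inord 1) = sigma_family n,
    H (inord 2) = sigma_family (fun kj : nat * nat => w kj.1 kj.2)
  & H (inord 3) = sigma_family delta].
  by rewrite /H !inordK.
have [H0 H1 H2 H3] := HE.
have Hall (Q : set (set T) -> Prop) : Q (H (inord 0)) -> Q (H (inord 1)) ->
    Q (H (inord 2)) -> Q (H (inord 3)) -> forall k, Q (H k).
  move=> Q0 Q1 Q2 Q3 [[|[|[|[|//]]]] k4];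
  [move: Q0|move: Q1|move: Q2|move: Q3]; congr (Q (H _));
  by apply/val_inj; rewrite /= inordK.
apply: (@mutually_independent_colour _ _ _ _ _ _ source_family _ H) => //.
- case=> [|k|k j|k] /=; rewrite ?H0 ?H1 ?H2 ?H3//.
  + exact: (@rv_system_family _ _ _ n k).
  + exact: (@rv_system_family _ _ _ (fun kj : nat * nat => w kj.1 kj.2) (k, j)).
  + exact: (@rv_system_family _ _ _ delta k).
- by apply: (Hall (fun X => X setT)); rewrite ?H0 ?H1 ?H2 ?H3; exact: sigma_familyT.
- by apply: (Hall (fun X => setI_closed X)); rewrite ?H0 ?H1 ?H2 ?H3; exact: sigma_familyI.
move=> k J A.
have [->|[x0 x0J]] := fset_0Vmem J.
  by move=> *; rewrite set_fset0 bigcap_set0 probability_setT big_seq_fset0.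
move=> Jk JA.
have {Jk} Jx0 i : i \in J -> nat_of_ord (source_family i) = source_family x0.
  by move=> iJ; rewrite !Jk.
case: x0 Jx0 x0J => [|k0|k0 j0|k0] /= Jx0 x0J.
- have -> : J = [fset Times]%fset.
    apply/fsetP => i; rewrite inE; apply/idP/eqP => [/Jx0|->//].
    by case: i => [|i|i j|i] //=; rewrite !inordK.
  by rewrite set_fset1 bigcap_set1 big_seq_fset1.
- apply: (@mutually_independent_reindex _ _ _ _ _ _ source_sigma Size
    (fun s => if s is Size k then k else 0%N)) => //.
  by case=> [|i|i j|i] // /Jx0; rewrite /= !inordK.
- apply: (@mutually_independent_reindex _ _ _ _ _ _ source_sigma
    (fun kj : nat * nat => Weight kj.1 kj.2)
    (fun s => if s is Weight k j then (k, j) else (0, 0)%N)) => //.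
    by case.
  by case=> [|i|i j|i] // /Jx0; rewrite /= !inordK.
- apply: (@mutually_independent_reindex _ _ _ _ _ _ source_sigma Gap
    (fun s => if s is Gap k then k else 0%N)) => //.
  by case=> [|i|i j|i] // /Jx0; rewrite /= !inordK.
Qed.

End Sources.

(** * Attacks seen at a fixed time *)

Section CountEvents.
Context d (T : measurableType d) (R : realType) (P : probability T R).
Variable t : nat -> {RV P >-> R}.

(** For increasing times, exactly [l] attacks occur up to time [s]. The two
    neighbouring times decide it, which keeps the event jointly measurable in
    [s] and the times. *)
Definition seen (l : nat) (s : R) (omega : T) : bool :=
  ((l == 0)%N || (t l.-1 omega <= s)) && (s < t l omega).

Definition increasing_times (omega : T) : Prop :=
  0 < t 0%N omega /\ forall k, t k omega < t k.+1 omega.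

Lemma increasing_times_mono omega i j : increasing_times omega ->
  (t i omega <= t j omega) = (i <= j)%N.
Proof.
move=> [_ tS].
have lt k m : t k omega < t (k + m.+1)%N omega.
  by elim: m => [|m IH]; rewrite ?addn1// addnS (lt_trans IH).
case: (leqP i j) => ij.
  rewrite -(subnKC ij); case: (j - i)%N => [|m]; first by rewrite addn0 lexx.
  by rewrite ltW.
by apply/negbTE; rewrite -ltNge -(subnKC ij) addSnnS lt.
Qed.

Lemma increasing_times_seen omega l s k : increasing_times omega ->
  seen l s omega -> (t k omega <= s) = (k < l)%N.
Proof.
move=> tS /andP[ls sl]; apply/idP/idP => [ks|kl].
  by have := le_lt_trans ks sl; rewrite ltNge increasing_times_mono// -ltnNge.
case/orP: ls => [/eqP l0|ls]; first by rewrite l0 in kl.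
by apply: le_trans ls; rewrite increasing_times_mono//; lia.
Qed.

Lemma seen_exists omega s k : increasing_times omega -> s < t k omega ->
  exists2 l, (l <= k)%N & seen l s omega.
Proof.
move=> tS sk; have ex : exists l, s < t l omega by exists k.
case: (ex_minnP ex) => l sl lmin; exists l; first exact: lmin.
rewrite /seen sl andbT; case: l sl lmin => //= l sl lmin.
by rewrite leNgt; apply/negP => /lmin; rewrite ltnn.
Qed.

Lemma seen_inj omega s l l' : increasing_times omega ->
  seen l s omega -> seen l' s omega -> l = l'.
Proof.
move=> tS sl sl'; apply/eqP; rewrite eqn_leq; apply/andP; split;
  rewrite leqNgt; apply/negP => ll.
  by have := increasing_times_seen l' tS sl; rewrite ll => ls; case/andP: sl' => _; rewrite ltNge ls.
by have := increasing_times_seen l tS sl'; rewrite ll => ls; case/andP: sl => _; rewrite ltNge ls.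
Qed.

(** If [l] attacks occur up to time [r], the later ones up to time [s] are
    consecutive from number [l] on, so their number is fixed by the first attack
    after [s]. *)
Lemma count_event_seen omega (l : nat) (r s : R) (j : nat) :
  increasing_times omega -> r <= s -> seen l r omega ->
  count_event t r s j omega <-> seen (l + j) s omega.
Proof.
move=> tS rs lr; rewrite /count_event /=.
have rt k : (r < t k omega) = (l <= k)%N.
  by rewrite ltNge (increasing_times_seen _ tS lr) -leqNgt.
have setE m : (l <= m)%N -> seen m s omega ->
    [set k | (r < t k omega <= s)%R] = `I_m `\` `I_l.
  move=> lm ms; apply/seteqP; split=> k /=; rewrite rt (increasing_times_seen _ tS ms).
    by move=> /andP[lk km]; split => //; apply/negP; rewrite -leqNgt.
  by move=> [-> /negP]; rewrite -leqNgt => ->.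
split=> [cj|js]; last first.
  by rewrite (setE _ (leq_addr _ _) js); have := @card_IID (l + j) l; rewrite addKn.
have fin : finite_set [set k | (r < t k omega <= s)%R] by apply/finite_setP; exists j.
have [k sk] : exists k, s < t k omega.
  apply: contrapT => nk.
  have sub : [set k | (l <= k)%N] `<=` [set k | (r < t k omega <= s)%R].
    by move=> k /=; rewrite rt => ->/=; rewrite leNgt; apply/negP => sk; apply: nk; exists k.
  have := sub_finite_set sub fin.
  have : infinite_set [set k | (l <= k)%N].
    move=> lf; apply: infinite_nat.
    have -> : [set: nat] = `I_l `|` [set k | (l <= k)%N].
      by apply/seteqP; split => k //= _; case: (ltnP k l) => ?; [left|right].
    by rewrite finite_setU; split => //; exact: finite_II.
  by [].
have [m _ ms] := seen_exists tS sk.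
have lm : (l <= m)%N.
  case: l lr rt setE => // l lr _ _.
  have : t l omega <= s by apply: le_trans rs; rewrite (increasing_times_seen _ tS lr).
  by rewrite (increasing_times_seen _ tS ms).
move: cj; rewrite (setE _ lm ms) => cj.
have : (`I_(m - l) #= `I_j)%card.
  by apply: card_eq_trans cj; rewrite card_eq_sym card_IID.
by move=> /card_eq_II mj; rewrite -mj subnKC.
Qed.

(** There are countably many finite sets of indices. *)
Lemma measurable_count_event r s j : measurable (count_event t r s j).
Proof.
have -> : count_event t r s j = \bigcup_(F : {fset nat})
    ([set omega | #|` F| = j] `&`
     \bigcap_k [set omega | (k \in F) = (r < t k omega <= s)%R]).
  apply/seteqP; split => omega; rewrite /count_event/=.
    move=> cj; have fin : finite_set [set k | (r < t k omega <= s)%R].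
      by apply/finite_setP; exists j.
    exists (fset_set [set k | (r < t k omega <= s)%R]) => //; split.
      exact: card_fset_set.
    by move=> k _ /=; rewrite in_fset_set//; apply/idP/idP; rewrite inE.
  move=> [F _ [Fj FE]].
  have -> : [set k | (r < t k omega <= s)%R] = [set` F].
    by apply/seteqP; split => k /=; rewrite (FE k).
  exact/card_eq_fsetP.
apply: countable_bigcupT_measurable; first exact: countableP.
move=> F; apply: measurableI.
  have [Fj|Fj] := pselect (#|` F| = j).
    by rewrite (_ : [set _ | _] = setT)//; apply/seteqP; split.
  by rewrite (_ : [set _ | _] = set0)//; apply/seteqP; split.
apply: bigcapT_measurable => k.
have mk : measurable [set omega | (r < t k omega <= s)%R].
  rewrite (_ : [set _ | _] = t k @^-1` `]r, s]); last first.
    by apply/seteqP; split => x /=; rewrite in_itv.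
  by rewrite -[X in measurable X]setTI; exact: measurable_funPT.
case: (k \in F).
  rewrite (_ : [set _ | _] = [set omega | (r < t k omega <= s)%R])//.
  by apply/seteqP; split => x /=; case: (_ < _ <= _).
rewrite (_ : [set _ | _] = ~` [set omega | (r < t k omega <= s)%R]).
  exact: measurableC.
by apply/seteqP; split => x /=; case: (_ < _ <= _).
Qed.

End CountEvents.

Section Model.
Context d (T : measurableType d) (R : realType) (P : probability T R).
Context (lam mu xi a b : R) (t : nat -> {RV P >-> R}) (n : nat -> {RV P >-> nat})
  (w : nat -> nat -> {RV P >-> R}) (delta : nat -> {RV P >-> R}).
Hypothesis model : network_attack lam mu xi a b t n w delta.
Hypothesis lam_gt0 : 0 < lam.
Hypothesis mu_gt0 : 0 < mu.

Local Notation G := (source_sigma t n w delta).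
Local Notation blockT J := (g_sigma_algebraType (block G J)).

Lemma model_block_indep J1 J2 A B : J1 `&` J2 = set0 ->
  <<s block G J1 >> A -> <<s block G J2 >> B -> P (A `&` B) = (P A * P B)%E.
Proof.
apply: block_indep.
- exact: source_sigmaT.
- exact: source_sigmaI.
- by move=> i A'; exact: source_sigma_measurable.
- apply: sources_independent.
  + exact: attack_sizes_indep model.
  + exact: node_weights_indep model.
  + exact: observation_gaps_indep model.
  + exact: families_indep model.
Qed.

Lemma model_block_measurable J A : <<s block G J >> A -> measurable A.
Proof. by apply: block_sigma_measurable => i A'; exact: source_sigma_measurable. Qed.

Lemma measurable_id_block J : measurable_fun setT (id : T -> blockT J).
Proof. by move=> _ A mA; rewrite setTI; exact: model_block_measurable mA. Qed.

Lemma measurable_times J k : J Times -> measurable_fun setT (t k : blockT J -> R).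
Proof.
move=> Jt; apply: (block_measurable_fun Jt).
exact: (@rv_system_family _ T _ _ _ t k).
Qed.

Lemma measurable_gap J k : J (Gap k) -> measurable_fun setT (delta k : blockT J -> R).
Proof. by move=> Jt; apply: (block_measurable_fun Jt). Qed.

Lemma measurable_size J k : J (Size k) -> measurable_fun setT (n k : blockT J -> nat).
Proof. by move=> Jt; apply: (block_measurable_fun Jt). Qed.

Lemma measurable_weight J k j : J (Weight k j) ->
  measurable_fun setT (w k j : blockT J -> R).
Proof. by move=> Jt; apply: (block_measurable_fun Jt). Qed.

Lemma measurable_observation_time J k : (forall i, (i < k)%N -> J (Gap i)) ->
  measurable_fun setT (observation_time delta k : blockT J -> R).
Proof.
move=> JG; rewrite (_ : observation_time delta k = fun x => \sum_(i < k) delta i x)//.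
by apply: measurable_sum => i; apply: measurable_gap; exact: JG.
Qed.

Lemma measurable_seen d' (T' : measurableType d') (u : nat -> T' -> R) (s : T' -> R) l :
  (forall k, measurable_fun setT (u k)) -> measurable_fun setT s ->
  measurable_fun setT (fun x => ((l == 0)%N || (u l.-1 x <= s x)) && (s x < u l x)).
Proof.
move=> mt ms; apply: measurable_and; last exact: measurable_fun_ltr.
by apply: measurable_or; [exact: measurable_cst | exact: measurable_fun_ler].
Qed.

Lemma measurable_seen_cst l s : measurable [set omega | seen t l s omega].
Proof.
apply: measurable_bool_set; apply: (measurable_seen (u := fun k => t k) (s := cst s)) => //.
Qed.

Lemma ae_increasing_times : {ae P, forall omega, increasing_times t omega}.
Proof. exact: poisson_points_sorted (attack_times model). Qed.

Lemma seen_law l s : 0 < s ->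
  P [set omega | seen t l s omega] = (poisson_pmf (lam * s) l)%:E.
Proof.
move=> s0; have := poisson_points_law (attack_times model) l (lexx 0) s0.
rewrite subr0 => <-; apply: ae_eq_measure.
- exact: measurable_seen_cst.
- exact: measurable_count_event.
- apply: filterS ae_increasing_times => omega tS; rewrite /=.
  rewrite (@count_event_seen _ _ _ _ t omega 0 0 s l)//; first exact: ltW.
  by rewrite /seen /=; case: tS.
Qed.

Lemma seen_law0 l : P [set omega | seen t l 0 omega] = ((l == 0)%N%:R)%:E.
Proof.
case: l => [|l].
  rewrite eqxx -(@probability_setT _ _ _ P); apply: ae_eq_measure => //.
    exact: measurable_seen_cst.
  by apply: filterS ae_increasing_times => omega [t0 tS]; split => //= _; rewrite /seen.
transitivity (P set0); last by rewrite measure0.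
apply: ae_eq_measure => //.
  exact: measurable_seen_cst.
apply: filterS ae_increasing_times => omega tS; split => //= /andP[/= tl _].
have t00 : seen t 0 0 omega by rewrite /seen/=; case: tS.
by have := increasing_times_seen l tS t00; rewrite tl.
Qed.

(** Independence of the increments from 0 to [s] and from [s] to [s']. When
    [s = 0] the former is empty, and almost surely no attack is seen at 0. *)
Lemma seen_joint_law l j s s' : 0 <= s -> s < s' ->
  P [set omega | seen t l s omega && seen t (l + j) s' omega] =
  (P [set omega | seen t l s omega] * (poisson_pmf (lam * (s' - s)) j)%:E)%E.
Proof.
move=> s0 ss'.
have mj : measurable [set omega | seen t l s omega && seen t (l + j) s' omega].
  rewrite (_ : [set _ | _] = [set omega | seen t l s omega] `&` [set omega | seen t (l + j) s' omega]).
    by apply: measurableI; exact: measurable_seen_cst.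
  by apply/seteqP; split => x /= /andP.
move: s0; rewrite le_eqVlt => /predU1P[s0|s0].
  rewrite -s0 subr0 in ss' mj *; rewrite seen_law0.
  case: l mj => [|l] mj.
    rewrite eqxx mul1e add0n -seen_law//; apply: ae_eq_measure => //.
      exact: measurable_seen_cst.
    apply: filterS ae_increasing_times => omega [t0 tS]; rewrite /=.
    by rewrite {1}/seen /= t0.
  rewrite mul0e; apply/eqP; rewrite eq_le measure_ge0 andbT.
  apply: le_trans (_ : P [set omega | seen t l.+1 0 omega] <= 0)%E; last first.
    by rewrite seen_law0.
  apply: le_measure; rewrite ?inE//; first exact: measurable_seen_cst.
  by move=> x /= /andP[].
(* The increments over an infinite sequence of times are assumed independent;
   the times after [s'] are arbitrary. *)
pose sq (i : nat) : R := if i is k.+1 then (if k is k'.+1 then s' + k'%:R else s) else 0.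
have sq0 : 0 <= sq 0%N by [].
have sqS i : sq i < sq i.+1.
  by case: i => [|[|i]] //=; rewrite ?addr0// ltrD2l ltr_nat.
have := poisson_points_indep (attack_times model) sq0 sqS.
move=> /(_ [fset 0%N; 1%N]%fset (fun i => if i == 0%N then count_event t 0 s l else
   count_event t s s' j)).
rewrite big_fsetU1/=; last by rewrite inE.
rewrite big_seq_fset1/= seen_law//.
have := poisson_points_law (attack_times model) l (lexx 0) s0.
rewrite subr0 => <-.
rewrite -(poisson_points_law (attack_times model) j (ltW s0) ss').
move=> <-; last first.
  move=> i; rewrite !inE => /orP[|] /eqP -> /=; first by exists l.
  by exists j => //; rewrite addr0.
apply: ae_eq_measure => //.
  rewrite (_ : \bigcap_(i in _) _ = count_event t 0 s l `&` count_event t s s' j).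
    by apply: measurableI; exact: measurable_count_event.
  apply/seteqP; split => x /=.
    by move=> h; split; [apply: (h 0%N)|apply: (h 1%N)]; rewrite /= !inE.
  by move=> [h0 h1] i /=; rewrite !inE => /orP[|] /eqP ->.
apply: filterS ae_increasing_times => omega tS /=.
have t00 : seen t 0 0 omega by rewrite /seen/=; case: tS.
split.
  move=> /andP[sl slj] i /=; rewrite !inE => /orP[|] /eqP -> /=.
    by apply/(count_event_seen _ tS (ltW s0) t00).
  by apply/(count_event_seen _ tS (ltW ss') sl).
move=> h; have /= h0 := h 0%N; have /= h1 := h 1%N.
have sl : seen t l s omega.
  by apply/(count_event_seen _ tS (ltW s0) t00); apply: h0; rewrite !inE.
by rewrite sl /=; apply/(count_event_seen _ tS (ltW ss') sl); apply: h1; rewrite !inE.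
Qed.

End Model.

(** * Attacks seen at the observation times *)

Section RandomTimes.
Context d (T : measurableType d) (R : realType) (P : probability T R).
Context (lam mu xi a b : R) (t : nat -> {RV P >-> R}) (n : nat -> {RV P >-> nat})
  (w : nat -> nat -> {RV P >-> R}) (delta : nat -> {RV P >-> R}).
Hypothesis model : network_attack lam mu xi a b t n w delta.
Hypothesis lam_gt0 : 0 < lam.
Hypothesis mu_gt0 : 0 < mu.

Local Notation G := (source_sigma t n w delta).
Local Notation blockT J := (g_sigma_algebraType (block G J)).
Local Notation tau := (observation_time delta).

Let p := mu / (lam + mu).
Let q := lam / (lam + mu).

Lemma ae_gap_gt0 : {ae P, forall omega, forall k, 0 < delta k omega}.
Proof.
apply/ae_foralln => k.
exists (delta k @^-1` `]-oo, 0]); split.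
- by rewrite -[X in measurable X]setTI; exact: measurable_funPT.
- rewrite -[LHS]/(distribution P (delta k) `]-oo, 0%R]) (observation_gaps_law model)//.
  rewrite /exponential_prob -integral_itv_bndo_bndc; last first.
    by apply/measurable_funTS/measurable_EFinP; exact: measurable_exponential_pdf.
  rewrite integral0_eq// => x /=; rewrite in_itv/= => x0.
  by rewrite lt0_exponential_pdf.
- by move=> omega /= /negP; rewrite -leNgt in_itv/=.
Qed.

Lemma observation_time0 omega : tau 0 omega = 0.
Proof. by rewrite /observation_time big_ord0. Qed.

Lemma observation_timeS k omega : tau k.+1 omega = tau k omega + delta k omega.
Proof. by rewrite /observation_time big_ord_recr. Qed.

Lemma ae_observation_time_ge0 k : {ae P, forall omega, 0 <= tau k omega}.
Proof.
apply: filterS ae_gap_gt0 => omega d0; apply: sumr_ge0 => i _; exact: ltW.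
Qed.

Definition gaps_below (k : nat) : set source := [set s | exists2 i, s = Gap i & (i < k)%N].

Lemma measurable_tau k : measurable_fun setT (tau k : T -> R).
Proof. by apply: measurable_sum => i; exact: measurable_funPT. Qed.

Lemma measurable_seen_tau_fun l k :
  measurable_fun setT (fun omega => seen t l (tau k omega) omega).
Proof.
apply: (measurable_seen (u := fun k => t k) (s := tau k)) => //.
exact: measurable_tau.
Qed.

Lemma measurable_seen_tau l k : measurable [set omega | seen t l (tau k omega) omega].
Proof. exact: measurable_bool_set (measurable_seen_tau_fun l k). Qed.

(** The attack times are independent of the gaps, so an observation time can be
    frozen while the attack times are averaged out. *)
Lemma times_decouple d' (T' : measurableType d') (Y : T -> T') J
    (C : blockT [set Times] * T' -> bool) :
  ~ J Times -> measurable_fun setT (Y : blockT J -> T') -> measurable_fun setT C ->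
  P [set omega | C (omega, Y omega)] =
  (\int[P]_omega' P [set omega | C (omega, Y omega')])%E.
Proof.
move=> JT mY mC.
have mY' : measurable_fun [set: T] Y.
  by apply: (measurableT_comp mY); exact: measurable_id_block.
apply: (@measure_decouple _ _ _ P _ _ _ _ (id : T -> blockT [set Times]) Y) => //.
  exact: measurable_id_block.
move=> A B mA mB; apply: (model_block_indep model (J1 := [set Times]) (J2 := J)) => //.
- by apply/seteqP; split => // s [/= ->].
- by rewrite -[Y @^-1` B]setTI; exact: mY.
Qed.

(** With the observation times frozen, [seen_joint_law] gives a product of a
    function of [tau k] and a Poisson weight in the next gap. These two are
    independent, and the second averages to a geometric weight by
    [integral_poisson_mixture]. *)
Lemma seen_tauS k l j :
  P [set omega | seen t l (tau k omega) omega && seen t (l + j) (tau k.+1 omega) omega] =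
  (P [set omega | seen t l (tau k omega) omega] * (p * q ^+ j)%:E)%E.
Proof.
(* The probability that [l] attacks are seen at time [s >= 0], as an explicit
   measurable function of [s]. *)
pose phi (s : R) : R := if 0 < s then poisson_pmf (lam * s) l else (l == 0)%N%:R.
have phiE s : 0 <= s -> P [set omega | seen t l s omega] = (phi s)%:E.
  rewrite le_eqVlt /phi => /predU1P[<-|s0]; first by rewrite ltxx (seen_law0 model).
  by rewrite s0 (seen_law model).
have phi0 s : 0 <= phi s by rewrite /phi; case: ifPn => // _; exact: poisson_pmf_ge0.
have mpois i : measurable_fun setT (fun x : R => poisson_pmf (lam * x) i).
  apply: (@measurableT_comp _ _ _ _ _ _ (@poisson_pmf R ^~ i)) => //.
  exact: measurable_poisson_pmf.
have mphi : measurable_fun setT phi.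
  apply: measurable_fun_if => //; first exact: measurable_fun_ltr.
  exact: measurable_funTS.
have mt i : measurable_fun setT (t i : blockT [set Times] -> R) by exact: measurable_times.
have mtau : measurable_fun setT (tau k : blockT (gaps_below k) -> R).
  by apply: measurable_observation_time => i ik; exists i.
have mtau' : measurable_fun setT (tau k : blockT (gaps_below k.+1) -> R).
  by apply: measurable_observation_time => i ik; exists i => //; exact: ltnW.
have mdelta : measurable_fun setT (delta k : blockT (gaps_below k.+1) -> R).
  by apply: measurable_gap; exists k.
transitivity (\int[P]_omega' ((phi (tau k omega'))%:E * (poisson_pmf (lam * delta k omega') j)%:E))%E.
  pose C (z : blockT [set Times] * (R * R)) : bool :=
    (((l == 0)%N || (t l.-1 z.1 <= z.2.1)) && (z.2.1 < t l z.1)) &&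
    (((l + j == 0)%N || (t (l + j).-1 z.1 <= z.2.1 + z.2.2)) && (z.2.1 + z.2.2 < t (l + j) z.1)).
  have mC : measurable_fun setT C.
    have m1 i : measurable_fun setT (fun z : blockT [set Times] * (R * R) => t i z.1).
      by apply: measurableT_comp.
    have m2 : measurable_fun setT (fun z : blockT [set Times] * (R * R) => z.2.1).
      by apply: measurableT_comp.
    have m3 : measurable_fun setT (fun z : blockT [set Times] * (R * R) => z.2.2).
      by apply: measurableT_comp.
    apply: measurable_and.
      exact: (measurable_seen (u := fun i (z : blockT [set Times] * (R * R)) => t i z.1) (s := fun z => z.2.1)).
    apply: (measurable_seen (u := fun i (z : blockT [set Times] * (R * R)) => t i z.1) (s := fun z => z.2.1 + z.2.2)) => //.
    exact: measurable_funD.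
  transitivity (P [set omega | C (omega, (tau k omega, delta k omega))]).
    congr (P _); apply/seteqP; split => omega; rewrite /= /C /seen /= observation_timeS//.
  rewrite (@times_decouple _ _ (fun omega => (tau k omega, delta k omega)) (gaps_below k.+1))//.
  - apply: ae_eq_integral_setT.
    apply: filterS2 (ae_observation_time_ge0 k) ae_gap_gt0 => omega tau0 d0.
    rewrite -phiE//.
    rewrite -[X in poisson_pmf (lam * X)](addrK (tau k omega)) [delta k omega + _]addrC.
    by rewrite -(seen_joint_law model)// ltrDl.
  - by move=> [].
  - exact: measurable_fun_pair.
have intphi : (\int[P]_omega' (phi (tau k omega'))%:E)%E = P [set omega | seen t l (tau k omega) omega].
  pose C (z : blockT [set Times] * R) : bool :=
    (((l == 0)%N || (t l.-1 z.1 <= z.2)) && (z.2 < t l z.1)).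
  have mC : measurable_fun setT C.
    have m1 i : measurable_fun setT (fun z : blockT [set Times] * R => t i z.1).
      by apply: measurableT_comp.
    apply: (measurable_seen (u := fun i (z : blockT [set Times] * R) => t i z.1) (s := fun z => z.2)) => //; exact: measurable_snd.
  transitivity (P [set omega | C (omega, tau k omega)]); last by [].
  rewrite (@times_decouple _ _ (tau k) (gaps_below k) C)//; last by move=> [].
  apply: ae_eq_integral_setT.
  by apply: filterS (ae_observation_time_ge0 k) => omega tau0; rewrite -phiE.
rewrite -intphi.
rewrite (@ge0_integral_indepM _ _ _ P _ _ _ _ (tau k) (delta k) _ _ _
  (fun s => (phi s)%:E) (fun y => (poisson_pmf (lam * y) j)%:E)).
- congr (_ * _)%E.
  exact: (integral_poisson_mixture mu_gt0 (observation_gaps_law model k)).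
- exact: measurable_tau.
- exact: measurable_funPT.
- move=> A B mA mB.
  apply: (model_block_indep model (J1 := gaps_below k) (J2 := [set Gap k])).
  + by apply/seteqP; split => // s [[i -> ik] /= [ki]]; move: ik; rewrite ki ltnn.
  + by rewrite -[X in <<s _ >> X]setTI; exact: mtau.
  + by rewrite -[X in <<s _ >> X]setTI; exact: (@measurable_gap _ _ _ _ t n w delta [set Gap k] k).
- exact/measurable_EFinP.
- exact/measurable_EFinP.
- by move=> s; rewrite lee_fin.
- by move=> y; rewrite lee_fin poisson_pmf_ge0.
Qed.

End RandomTimes.

Section PassagePieces.
Context d (T : measurableType d) (R : realType) (P : probability T R).
Context (lam mu xi a b : R) (t : nat -> {RV P >-> R}) (n : nat -> {RV P >-> nat})
  (w : nat -> nat -> {RV P >-> R}) (delta : nat -> {RV P >-> R}).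
Hypothesis model : network_attack lam mu xi a b t n w delta.
Hypothesis lam_gt0 : 0 < lam.
Hypothesis mu_gt0 : 0 < mu.
Local Notation tau := (observation_time delta).

Let p := mu / (lam + mu).
Let q := lam / (lam + mu).

Let lm_gt0 : 0 < lam + mu. Proof. exact: addr_gt0. Qed.
Let p_gt0 : 0 < p. Proof. exact: divr_gt0. Qed.
Let q_gt0 : 0 < q. Proof. exact: divr_gt0. Qed.
Let pq1 : p + q = 1.
Proof. by rewrite /p /q -mulrDl addrC divff// gt_eqF. Qed.

Let qE : q = 1 - p. Proof. by rewrite -pq1 addrAC subrr add0r. Qed.

Definition good_times (omega : T) : Prop :=
  increasing_times t omega /\ forall k, 0 < delta k omega.

Lemma ae_good_times : {ae P, forall omega, good_times omega}.
Proof.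
by apply: filterS2 (ae_increasing_times model) (ae_gap_gt0 model) => omega.
Qed.

Lemma good_tau_lt omega j k : good_times omega -> (j < k)%N ->
  tau j omega < tau k omega.
Proof.
move=> [_ d0]; elim: k => // k IH; rewrite ltnS leq_eqVlt observation_timeS => /predU1P[->|/IH jk].
  by rewrite ltrDl.
by apply: lt_trans jk _; rewrite ltrDl.
Qed.

Lemma good_tau_le omega j k : good_times omega -> (j <= k)%N ->
  tau j omega <= tau k omega.
Proof.
move=> gw; rewrite leq_eqVlt => /predU1P[->//|jk]; exact/ltW/good_tau_lt.
Qed.

Lemma measurable_tau_lt l k : measurable_fun setT (fun omega => tau k omega < t l omega).
Proof. by apply: measurable_fun_ltr => //; exact: measurable_tau. Qed.

(** The last observation before attack [l] is number [k], and it sees [i]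
    attacks. *)
Definition strikes (k i l : nat) (omega : T) : bool :=
  seen t i (tau k omega) omega && (t l omega <= tau k.+1 omega).

Lemma measurable_strikes k i l : measurable_fun setT (strikes k i l).
Proof.
apply: measurable_and; first exact: measurable_seen_tau_fun.
by apply: measurable_fun_ler => //; exact: measurable_tau.
Qed.

Definition seen_prob k l := fine (P [set omega | seen t l (tau k omega) omega]).
Definition before_prob k l := fine (P [set omega | tau k omega < t l omega]).

Lemma seen_probE k l : P [set omega | seen t l (tau k omega) omega] = (seen_prob k l)%:E.
Proof. by rewrite /seen_prob fineK// fin_num_measure//; exact: measurable_seen_tau. Qed.

Lemma before_probE k l : P [set omega | tau k omega < t l omega] = (before_prob k l)%:E.
Proof.
rewrite /before_prob fineK// fin_num_measure//; apply: measurable_bool_set.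
exact: measurable_tau_lt.
Qed.

Lemma seen_prob_ge0 k l : 0 <= seen_prob k l.
Proof. exact: fine_ge0. Qed.

Lemma seen_le omega i j s s' : increasing_times t omega -> s <= s' ->
  seen t i s omega -> seen t j s' omega -> (i <= j)%N.
Proof.
move=> tS ss' si /andP[_ sj]; rewrite leqNgt -(increasing_times_seen _ tS si) -ltNge.
exact: le_lt_trans ss' sj.
Qed.

(** Remove from the event that observation [k] sees [i] attacks the finitely
    many cases in which observation [k.+1] still precedes attack [l]; these
    have geometric probabilities by [seen_tauS]. *)
Lemma strikes_law k i l : (i <= l)%N ->
  P [set omega | strikes k i l omega] = (seen_prob k i * q ^+ (l - i).+1)%:E.
Proof.
move=> il; pose m := (l - i).+1.
have : P [set omega | seen t i (tau k omega) omega] =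
    (P [set omega | strikes k i l omega] +
     \sum_(j < m) (seen_prob k i * (p * q ^+ j))%:E)%E.
  under eq_bigr do rewrite EFinM -seen_probE -(seen_tauS model)//.
  (* Case 0 is the strike; case [j.+1] has [j] attacks in the next gap. *)
  pose c (j : nat) omega := if j is j'.+1 then
     seen t i (tau k omega) omega && seen t (i + j') (tau k.+1 omega) omega
     else strikes k i l omega.
  rewrite (@measure_ae_partition _ _ _ P m.+1 _ c); first by rewrite big_ord_recl.
  - exact: measurable_seen_tau_fun.
  - case=> [|j]; first exact: measurable_strikes.
    by apply: measurable_and; exact: measurable_seen_tau_fun.
  - apply: filterS ae_good_times => omega gw; have [tS d0] := gw.
    have excl j : (j < m)%N -> strikes k i l omega ->
        seen t (i + j) (tau k.+1 omega) omega -> False.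
      move=> jm /andP[_ tl] sj; move: tl; rewrite (increasing_times_seen _ tS sj).
      by rewrite /m in jm; lia.
    apply: (@sum_bool_unique m.+1 _ (c^~ omega)).
      move=> [|j] [|j'] //=.
      + by move=> _ jm str /andP[_ /(excl _ jm)]; case/(_ str).
      + by move=> jm _ /andP[_ sj] str; case: (excl _ jm str sj).
      + by move=> _ _ /andP[_ sj] /andP[_ sj']; have := seen_inj tS sj sj'; lia.
    split=> [si|[[|j] _ /=]]; [|by case/andP..].
    case: (leP (t l omega) (tau k.+1 omega)) => [tl|tl].
      by exists 0%N => //=; rewrite /strikes si tl.
    have [l' l'l sl'] := seen_exists tS tl.
    have il' := seen_le tS (good_tau_le gw (leqnSn k)) si sl'.
    by exists (l' - i).+1; rewrite /= ?subnKC ?si//; rewrite /m; lia.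
rewrite sumEFin -mulr_sumr (geometric_mass qE) seen_probE => /esym.
have : P [set omega | strikes k i l omega] \is a fin_num.
  by apply: fin_num_measure; apply: measurable_bool_set; exact: measurable_strikes.
case: (P _) => //= x _; rewrite -EFinD => -[h]; congr EFin.
by move: h; rewrite mulrBr mulr1 /m; lra.
Qed.

Lemma before_prob_sum k l : before_prob k l = \sum_(i < l.+1) seen_prob k i.
Proof.
apply: EFin_inj; rewrite -before_probE -sumEFin.
under eq_bigr do rewrite -seen_probE.
apply: (@measure_ae_partition _ _ _ P _ _ (fun i omega => seen t i (tau k omega) omega)).
- exact: measurable_tau_lt.
- by move=> i; exact: measurable_seen_tau_fun.
- apply: filterS ae_good_times => omega gw; have [tS d0] := gw.
  apply: (@sum_bool_unique l.+1 _ (fun i => seen t i (tau k omega) omega)) => [i j _ _|]; first exact: seen_inj.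
  split=> [tl|[i il si]].
    by have [i il si] := seen_exists tS tl; exists i.
  by rewrite ltNge (increasing_times_seen _ tS si) -leqNgt; lia.
Qed.

(** If observation [k] precedes attack [l], then either the next one does too,
    or attack [l] strikes in between. *)
Lemma before_probS k l :
  before_prob k l = before_prob k.+1 l + \sum_(i < l.+1) seen_prob k i * q ^+ (l - i).+1.
Proof.
apply: EFin_inj; rewrite EFinD -!before_probE -sumEFin.
have -> : (\sum_(i < l.+1) (seen_prob k i * q ^+ (l - i).+1)%:E =
    \sum_(i < l.+1) P [set omega | strikes k i l omega])%E.
  by apply: eq_bigr => i _; rewrite strikes_law// -ltnS.
pose c (i : nat) omega := if i is i'.+1 then strikes k i' l omega
  else tau k.+1 omega < t l omega.
rewrite (@measure_ae_partition _ _ _ P l.+2 _ c); first by rewrite big_ord_recl.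
- exact: measurable_tau_lt.
- by case=> [|i]; [exact: measurable_tau_lt | exact: measurable_strikes].
- apply: filterS ae_good_times => omega gw; have [tS d0] := gw.
  apply: (@sum_bool_unique l.+2 _ (c^~ omega)) => [[|i] [|j] //= _ _|].
  + by move=> tl /andP[_]; rewrite leNgt tl.
  + by move=> /andP[_ tl]; rewrite ltNge tl.
  + by move=> /andP[si _] /andP[sj _]; congr _.+1; exact: seen_inj si sj.
  split=> [tl|[[|i] il /=]].
  + case: (leP (t l omega) (tau k.+1 omega)) => tl'; last by exists 0%N.
    have [i il si] := seen_exists tS tl.
    by exists i.+1 => //=; rewrite /strikes si tl'.
  + by apply: lt_trans; exact: good_tau_lt.
  + move=> /andP[si _].
    by rewrite ltNge (increasing_times_seen _ tS si) -leqNgt; lia.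
Qed.

Lemma before_prob0 l : before_prob 0 l = 1.
Proof.
apply: EFin_inj; rewrite -before_probE -(@probability_setT _ _ _ P).
apply: ae_eq_measure => //; first by apply: measurable_bool_set; exact: measurable_tau_lt.
apply: filterS ae_good_times => omega [tS d0]; split => // _ /=.
rewrite observation_time0; apply: lt_le_trans tS.1 _.
by rewrite increasing_times_mono.
Qed.

(** By [below_cvg0], each attack is almost surely followed by an observation.
    This makes the passage index finite. *)
Lemma ae_times_passed : {ae P, forall omega, forall l, exists k, t l omega <= tau k omega}.
Proof.
apply/ae_foralln => l; exists (\bigcap_k [set omega | tau k omega < t l omega]); split.
- apply: bigcapT_measurable => k; apply: measurable_bool_set; exact: measurable_tau_lt.
- apply/eqP; rewrite eq_le measure_ge0 andbT; apply/lee_addgt0Pr => e e0.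
  have := below_cvg0 p_gt0 q_gt0 pq1 seen_prob_ge0 before_prob0 before_prob_sum before_probS l.
  move=> /cvgrPdist_lt /(_ _ e0)[k _ /(_ k (leqnn k))].
  rewrite sub0r normrN => /(le_lt_trans (ler_norm _)) /ltW ke.
  rewrite add0e; apply: le_trans (_ : (before_prob k l)%:E <= _)%E; last by rewrite lee_fin.
  rewrite -before_probE; apply: le_measure; rewrite ?inE.
  + apply: bigcapT_measurable => j; apply: measurable_bool_set; exact: measurable_tau_lt.
  + by apply: measurable_bool_set; exact: measurable_tau_lt.
  + by move=> omega; apply.
- move=> omega /= h k _ /=; rewrite ltNge; apply/negP => tk; apply: h; by exists k.
Qed.

Lemma nneseries_strikes (f : nat -> R) (K : nat) :
  f 0 = 1 -> (forall l, 0 <= f l) -> (forall l, (K < l)%N -> f l = 0) ->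
  (\sum_(l <oo) \sum_(k <oo) \sum_(i < l.+1)
     (P [set omega | strikes k i l omega] * (f i)%:E) =
   (lam / mu + \sum_(i < K.+1) f i)%:E)%E.
Proof.
move=> f0 f_ge0 f_eq0.
have := nneseries_passes p_gt0 q_gt0 pq1 seen_prob_ge0 before_prob0 before_prob_sum before_probS f0 f_ge0 f_eq0.
have -> : q / p = lam / mu by rewrite /q /p; field; rewrite !gt_eqF.
move=> <-; apply: eq_eseriesr => l _; apply: eq_eseriesr => k _; apply: eq_bigr => i _.
by rewrite strikes_law -?EFinM// -ltnS.
Qed.

End PassagePieces.

(** * Sizes and weights of the first attacks *)

Section Attacks.
Context d (T : measurableType d) (R : realType) (P : probability T R).
Context (lam mu xi a b : R) (t : nat -> {RV P >-> R}) (n : nat -> {RV P >-> nat})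
  (w : nat -> nat -> {RV P >-> R}) (delta : nat -> {RV P >-> R}).
Hypothesis model : network_attack lam mu xi a b t n w delta.
Hypothesis xi_gt0 : 0 < xi.
Hypothesis a_gt0 : 0 < a.
Hypothesis a_lt1 : a < 1.
Hypothesis bE : b = 1 - a.
Local Notation G := (source_sigma t n w delta).
Local Notation blockT J := (g_sigma_algebraType (block G J)).

(** Induction on the list: each step is a convolution with an independent
    exponential variable. *)
Lemma weights_law (s : seq (nat * nat)) v : uniq s ->
  P [set omega | \sum_(kj <- s) w kj.1 kj.2 omega < v] = (gamma_cdf xi (size s) v)%:E.
Proof.
pose J (s : seq (nat * nat)) : set source :=
  [set x | exists2 kj, kj \in s & x = Weight kj.1 kj.2].
have mJ (K : set source) s' : (forall kj, kj \in s' -> K (Weight kj.1 kj.2)) ->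
    measurable_fun setT (fun omega : blockT K => \sum_(kj <- s') w kj.1 kj.2 omega).
  elim: s' => [|kj s2 IH] sub.
    by under eq_fun do rewrite big_nil; exact: measurable_cst.
  under eq_fun do rewrite big_cons.
  apply: measurable_funD.
    by apply: measurable_weight; apply: sub; rewrite mem_head.
  by apply: IH => x xs; apply: sub; rewrite inE xs orbT.
elim: s v => [|kj s IH] v /=.
  move=> _; rewrite /gamma_cdf /poisson_cdf big_ord0 subr0.
  under eq_set do rewrite big_nil.
  case: ifPn => v0; first by rewrite (_ : [set _ | _] = setT) ?probability_setT//; apply/seteqP; split.
  by rewrite (_ : [set _ | _] = set0) ?measure0//; apply/seteqP; split => // x /=; apply/negP.
move=> /andP[kjs us].
have G0 x : 0 <= gamma_cdf xi (size s) x by rewrite -lee_fin -IH.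
have mw k j : measurable_fun setT (w k j) by exact: measurable_funPT.
have ms : measurable_fun [set: T] (fun omega => \sum_(kj <- s) w kj.1 kj.2 omega).
  by apply: measurable_sum => kj'.
pose C (z : R * R) : bool := z.1 + z.2 < v.
transitivity (P [set omega | C (\sum_(kj <- s) w kj.1 kj.2 omega, w kj.1 kj.2 omega)]).
  by congr (P _); apply/seteqP; split => omega; rewrite /C/= big_cons addrC.
rewrite (@measure_decouple _ _ _ P _ _ _ _ (fun omega => \sum_(kj <- s) w kj.1 kj.2 omega) (w kj.1 kj.2))//.
- rewrite -(integral_gamma_cdf xi_gt0 (node_weights_law model kj.1 kj.2))//.
  apply: eq_integral => omega' _; rewrite -IH//; congr (P _).
  by apply/seteqP; split => omega; rewrite /C/= ltrBrDr.
- move=> A B mA mB.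
  apply: (model_block_indep model (J1 := J s) (J2 := [set Weight kj.1 kj.2])).
  + apply/seteqP; split => // x [[kj' kj's ->]/= [e1 e2]].
    by move: kjs; rewrite [kj]surjective_pairing -e1 -e2 -surjective_pairing kj's.
  + by rewrite -[X in <<s _ >> X]setTI; apply: mJ => // kj' kj's; exists kj'.
  + by rewrite -[X in <<s _ >> X]setTI; exact: measurable_weight.
- by apply: measurable_fun_ltr => //; exact: measurable_funD.
Qed.

Definition size_sum l omega := (\sum_(i < l) n i omega)%N.
Definition weight_sum l omega := \sum_(i < l) attack_weight n w i omega.

Lemma grouped_weights_law l (k : nat -> nat) v :
  P [set omega | \sum_(i < l) \sum_(j < k i) w i j omega < v] =
  (gamma_cdf xi (\sum_(i < l) k i) v)%:E.
Proof.
pose s := [seq (i, j) | i <- iota 0 l, j <- iota 0 (k i)].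
have us : uniq s.
  apply: allpairs_uniq_dep; rewrite ?iota_uniq//; first by move=> *; exact: iota_uniq.
  by move=> [i j] [i' j'] _ _ /= [-> ->].
have ss : size s = (\sum_(i < l) k i)%N.
  rewrite size_allpairs_dep sumnE big_map -(big_mkord xpredT k) /index_iota subn0.
  by apply: eq_bigr => i _; rewrite size_iota.
rewrite -ss -weights_law//; congr (P _); apply: eq_set => omega; congr (_ < _).
rewrite /s big_allpairs_dep/=.
rewrite -(big_mkord xpredT (fun i => \sum_(j < k i) w i j omega)) /index_iota subn0.
apply: eq_bigr => i _.
by rewrite -(big_mkord xpredT (fun j => w i j omega)) /index_iota subn0.
Qed.

Definition sizes_below l : set source := [set s | exists2 i, s = Size i & (i < l)%N].

Lemma measurable_size_sum (J : set source) l : (forall i, (i < l)%N -> J (Size i)) ->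
  measurable_fun setT (size_sum l : blockT J -> nat).
Proof.
move=> JS; apply: (@measurable_sum_nat _ (blockT J) (fun i => n i : blockT J -> nat)) => i il.
by apply: measurable_size; exact: JS.
Qed.

(** The weights are independent of the sizes. Once the sizes are frozen with
    total [m], the total weight is a sum of [m] exponential variables. *)
Lemma calm_joint_law l m v :
  P [set omega | (size_sum l omega == m) && (weight_sum l omega < v)] =
  (P [set omega | size_sum l omega == m] * (gamma_cdf xi m v)%:E)%E.
Proof.
pose JW : set source := [set s | exists k j, s = Weight k j].
pose JS : set source := [set s | exists k, s = Size k].
pose C (z : blockT JW * blockT JS) : bool :=
  (size_sum l z.2 == m) && (\sum_(i < l) \sum_(j < n i z.2) w i j z.1 < v).
have mw i j : measurable_fun setT (w i j : blockT JW -> R).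
  by apply: measurable_weight; exists i, j.
have mn i : measurable_fun setT (n i : blockT JS -> nat).
  by apply: measurable_size; exists i.
have msz : measurable_fun setT (size_sum l : blockT JS -> nat).
  by apply: measurable_size_sum => i _; exists i.
have mC : measurable_fun setT C.
  apply: measurable_and.
    apply: (measurable_fun_nat (N := fun z : blockT JW * blockT JS => size_sum l z.2) (eq_op^~ m)).
    exact: measurableT_comp.
  apply: measurable_fun_ltr => //; apply: measurable_sum => i.
  apply: (@measurable_fun_select _ _ _ _ (fun z : blockT JW * blockT JS => n i z.2)
    (fun k z => \sum_(j < k) w i j z.1)).
    exact: measurableT_comp.
  by move=> k; apply: measurable_sum => j; exact: measurableT_comp.
transitivity (P [set omega | C (omega, omega)]); first by [].
rewrite (@measure_decouple _ _ _ P _ _ _ _ (id : T -> blockT JW) (id : T -> blockT JS))//.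
- under eq_integral => omega' _.
    rewrite (_ : P _ = ((size_sum l omega' == m)%:R%:E * (gamma_cdf xi m v)%:E)%E); last first.
      rewrite /C/=; case: eqP => [<-|_] /=.
        by rewrite mul1e -(grouped_weights_law l (fun i => n i omega') v).
      by rewrite mul0e (_ : [set _ | _] = set0) ?measure0//; apply/seteqP; split.
    over.
  have msz' : measurable_fun setT (fun omega : T => size_sum l omega == m).
    apply: (measurable_fun_nat (eq_op^~ m)).
    by apply: (@measurable_sum_nat _ T (fun i => n i)) => i _; exact: measurable_funPT.
  have g0 : (0 <= (gamma_cdf xi m v)%:E)%E.
    have := grouped_weights_law 1 (fun=> m) v; rewrite big_ord1 => <-.
    exact: measure_ge0.
  rewrite ge0_integralZr//; last exact: measurable_fun_bool_EFin.
  by rewrite measure_bool.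
- exact: measurable_id_block.
- exact: measurable_id_block.
- move=> A B mA mB; apply: (model_block_indep model (J1 := JW) (J2 := JS)) => //.
  by apply/seteqP; split => // s [[k [j ->]] [k']].
Qed.

End Attacks.

Section Calm.
Context d (T : measurableType d) (R : realType) (P : probability T R).
Context (lam mu xi a b : R) (t : nat -> {RV P >-> R}) (n : nat -> {RV P >-> nat})
  (w : nat -> nat -> {RV P >-> R}) (delta : nat -> {RV P >-> R}).
Hypothesis model : network_attack lam mu xi a b t n w delta.
Hypothesis xi_gt0 : 0 < xi.
Hypothesis a_gt0 : 0 < a.
Hypothesis a_lt1 : a < 1.
Hypothesis bE : b = 1 - a.
Local Notation G := (source_sigma t n w delta).
Local Notation blockT J := (g_sigma_algebraType (block G J)).

Lemma measurable_size_pred k (f : nat -> bool) : measurable_fun setT (fun omega => f (n k omega)).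
Proof. exact: (measurable_fun_nat f (measurable_funPT (n k))). Qed.

Lemma measurable_size_sum_pred l (f : nat -> bool) :
  measurable_fun setT (fun omega => f (size_sum n l omega)).
Proof.
apply: (measurable_fun_nat f).
by apply: (@measurable_sum_nat _ T (fun i => n i)) => i _; exact: measurable_funPT.
Qed.

Lemma size_eq_law k j : (0 < j)%N -> P [set omega | n k omega == j] = (a * b ^+ j.-1)%:E.
Proof.
move=> j0; rewrite -(attack_sizes_law model k j0); congr (P _).
by apply/seteqP; split => omega /= /eqP.
Qed.

Let b_ge0 : 0 <= b. Proof. by rewrite bE subr_ge0 ltW. Qed.
Let b_lt1 : b < 1. Proof. by rewrite bE ltrBlDr ltrDl. Qed.

Lemma size_mass k j :
  P [set omega | (0 < n k omega <= j)%N] = (1 - b ^+ j)%:E.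
Proof.
rewrite -(geometric_mass bE) -sumEFin.
under eq_bigr do rewrite -(size_eq_law k (ltn0Sn _)).
apply: (@measure_ae_partition _ _ _ P j _ (fun i omega => n k omega == i.+1)).
- exact: (measurable_size_pred k (fun m => 0 < m <= j)%N).
- by move=> i; exact: (measurable_size_pred k (eq_op^~ i.+1)).
- apply: aeW => omega; apply: (@sum_bool_unique j _ (fun i => n k omega == i.+1)).
    by move=> i i' _ _ /eqP-> /eqP[].
  split; first by case: (n k omega) => // m /= mj; exists m.
  by move=> [i ij /eqP ->].
Qed.

(** The sizes from 1 to [j] have total probability [1 - b ^+ j], which leaves
    nothing for the size 0 in the limit. *)
Lemma ae_size_gt0 : {ae P, forall omega, forall k, (0 < n k omega)%N}.
Proof.
apply/ae_foralln => k; exists [set omega | n k omega == 0%N]; split.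
- by apply: measurable_bool_set; exact: (measurable_size_pred k (eq_op^~ 0%N)).
- apply/eqP; rewrite eq_le measure_ge0 andbT; apply/lee_addgt0Pr => e e0.
  have : b ^+ j @[j --> \oo] --> (0 : R) by apply: cvg_expr; rewrite ger0_norm.
  move=> /cvgrPdist_lt /(_ _ e0)[j _ /(_ j (leqnn j))].
  rewrite sub0r normrN => /(le_lt_trans (ler_norm _)) /ltW je.
  rewrite add0e; apply: le_trans (_ : (b ^+ j)%:E <= _)%E; last by rewrite lee_fin.
  have -> : (b ^+ j)%:E = P (~` [set omega | (0 < n k omega <= j)%N]).
    rewrite probability_setC ?size_mass; last first.
      by apply: measurable_bool_set; exact: (measurable_size_pred k (fun m => 0 < m <= j)%N).
    by rewrite -EFinB; congr EFin; ring.
  apply: le_measure; rewrite ?inE.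
  + by apply: measurable_bool_set; exact: (measurable_size_pred k (eq_op^~ 0%N)).
  + apply: measurableC; apply: measurable_bool_set.
    exact: (measurable_size_pred k (fun m => 0 < m <= j)%N).
  + by move=> omega /= /eqP ->.
- by move=> omega /= /negP; rewrite -leqNgt leqn0.
Qed.

Lemma size_gt_law k j : P [set omega | (j < n k omega)%N] = (b ^+ j)%:E.
Proof.
have mj : measurable [set omega | (0 < n k omega <= j)%N].
  by apply: measurable_bool_set; exact: (measurable_size_pred k (fun m => 0 < m <= j)%N).
transitivity (P (~` [set omega | (0 < n k omega <= j)%N])).
  apply: ae_eq_measure.
  - by apply: measurable_bool_set; exact: (measurable_size_pred k (fun m => j < m)%N).
  - exact: measurableC.
  - apply: filterS ae_size_gt0 => omega n0 /=; rewrite n0 /= ltnNge.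
    by split => /negP.
by rewrite probability_setC// size_mass -EFinB; congr EFin; ring.
Qed.

Lemma ae_weight_ge0 : {ae P, forall omega, forall k j, 0 <= w k j omega}.
Proof.
apply/ae_foralln => k; apply/ae_foralln => j.
exists (w k j @^-1` `]-oo, 0[); split.
- by rewrite -[X in measurable X]setTI; exact: measurable_funPT.
- rewrite -[LHS]/(distribution P (w k j) `]-oo, 0%R[) (node_weights_law model)//.
  rewrite /exponential_prob integral0_eq// => x /=; rewrite in_itv/= => x0.
  by rewrite lt0_exponential_pdf.
- by move=> omega /= /negP; rewrite -ltNge in_itv/=.
Qed.

Definition size_sum_prob l m := fine (P [set omega | size_sum n l omega == m]).

Lemma size_sum_probE l m : P [set omega | size_sum n l omega == m] = (size_sum_prob l m)%:E.
Proof.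
rewrite /size_sum_prob fineK// fin_num_measure//; apply: measurable_bool_set.
exact: (measurable_size_sum_pred l (eq_op^~ m)).
Qed.

Lemma size_sum_prob0 m : size_sum_prob 0 m = (m == 0)%N%:R.
Proof.
apply: EFin_inj; rewrite -size_sum_probE /size_sum; case: eqP => [->|/eqP m0].
  by rewrite (_ : [set _ | _] = setT) ?probability_setT//;
    apply/seteqP; split => // omega _ /=; rewrite big_ord0.
rewrite (_ : [set _ | _] = set0) ?measure0//; apply/seteqP; split => // omega /=.
by rewrite big_ord0 eq_sym (negPf m0).
Qed.

Lemma size_sum_probS l m : size_sum_prob l.+1 m = \sum_(i < m) size_sum_prob l i * (a * b ^+ (m - i).-1).
Proof.
apply: EFin_inj; rewrite -size_sum_probE -sumEFin.
pose c i omega := (size_sum n l omega == i) && (n l omega == m - i)%N.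
rewrite (@measure_ae_partition _ _ _ P m _ c).
- apply: eq_bigr => i _; rewrite EFinM -size_sum_probE -(size_eq_law l); last first.
    by rewrite subn_gt0.
  rewrite -(model_block_indep model (J1 := sizes_below l) (J2 := [set Size l])).
  + by congr (P _); apply/seteqP; split => omega /= /andP.
  + by apply/seteqP; split => // s [[k ->] + /= [kl]]; rewrite kl ltnn.
  + apply: (@measurable_bool_set _ (blockT (sizes_below l))).
    apply: (measurable_fun_nat (eq_op^~ (val i)));
    by apply: measurable_size_sum => k kl; exists k.
  + apply: (@measurable_bool_set _ (blockT [set Size l])).
    by apply: (measurable_fun_nat (eq_op^~ (m - i)%N)); exact: measurable_size.
- exact: (measurable_size_sum_pred l.+1 (eq_op^~ m)).
- move=> i; apply: measurable_and; first exact: (measurable_size_sum_pred l (eq_op^~ i)).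
  exact: (measurable_size_pred l (eq_op^~ (m - i)%N)).
- apply: filterS ae_size_gt0 => omega n0.
  apply: (@sum_bool_unique m _ (c^~ omega)).
    by move=> i j _ _ /andP[/eqP <- _] /andP[/eqP <- _].
  rewrite /c /size_sum big_ord_recr/=; have nl := n0 l; split.
    move=> /eqP <-; exists (\sum_(i < l) n i omega)%N; last by rewrite eqxx addKn eqxx.
    by rewrite -[X in (X < _)%N]addn0 ltn_add2l.
  by move=> [i im /andP[/eqP -> /eqP ->]]; rewrite subnKC// ltnW.
Qed.

Variables (M : nat) (V : R).
Hypothesis M_gt0 : (0 < M)%N.
Hypothesis V_gt0 : 0 < V.

(** The condition for an observation that sees [l] attacks to lie inside the
    box. *)
Definition calm l omega : bool :=
  (size_sum n l omega < M)%N && (weight_sum n w l omega < V).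

Definition attacks_below l : set source :=
  [set s | (exists2 i, s = Size i & (i < l)%N) \/
           (exists i j, s = Weight i j /\ (i < l)%N)].

Lemma measurable_weight_sum (J : set source) l :
  (forall i, (i < l)%N -> J (Size i)) -> (forall i j, (i < l)%N -> J (Weight i j)) ->
  measurable_fun setT (weight_sum n w l : blockT J -> R).
Proof.
move=> JS JW; apply: measurable_sum => -[i il].
apply: (@measurable_fun_select _ _ (blockT J) _ (n i) (fun k omega => \sum_(j < k) w i j omega)).
  by apply: measurable_size; exact: JS.
by move=> k; apply: measurable_sum => j; apply: measurable_weight; exact: JW.
Qed.

Lemma measurable_calm (J : set source) l : attacks_below l `<=` J ->
  measurable_fun setT (calm l : blockT J -> bool).
Proof.
move=> sJ; apply: measurable_and.
  apply: (measurable_fun_nat (fun m => m < M)%N).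
  by apply: measurable_size_sum => i il; apply: sJ; left; exists i.
apply: measurable_fun_ltr => //; apply: measurable_weight_sum.
  by move=> i il; apply: sJ; left; exists i.
by move=> i j il; apply: sJ; right; exists i, j.
Qed.

Lemma measurable_calmT l : measurable_fun setT (calm l).
Proof.
apply: (measurableT_comp (measurable_calm (J := attacks_below l) (l := l) _)) => //.
exact: (@measurable_id_block _ _ _ _ t n w delta (attacks_below l)).
Qed.

Definition calm_prob l := \sum_(m < M) size_sum_prob l m * gamma_cdf xi m V.

Lemma calm_law l : P [set omega | calm l omega] = (calm_prob l)%:E.
Proof.
rewrite -sumEFin; under eq_bigr do rewrite EFinM -size_sum_probE -(calm_joint_law model xi_gt0).
apply: (@measure_ae_partition _ _ _ P M _
  (fun m omega => (size_sum n l omega == m) && (weight_sum n w l omega < V))).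
- exact: measurable_calmT.
- move=> m; apply: measurable_and; first exact: (measurable_size_sum_pred l (eq_op^~ m)).
  apply: measurable_fun_ltr => //.
  apply: (measurableT_comp (measurable_weight_sum (J := setT) (l := l) _ _)) => //.
  exact: (@measurable_id_block _ _ _ _ t n w delta setT).
- apply: aeW => omega.
  apply: (@sum_bool_unique M _ (fun m => (size_sum n l omega == m) && (weight_sum n w l omega < V))).
    by move=> i j _ _ /andP[/eqP <- _] /andP[/eqP <- _].
  split=> [/andP[sM wV]|[m mM /andP[/eqP sm wV]]].
    by exists (size_sum n l omega); rewrite ?eqxx.
  by rewrite /calm sm mM.
Qed.

Lemma gamma_cdf0 v : 0 < v -> gamma_cdf xi 0 v = 1.
Proof. by move=> v0; rewrite /gamma_cdf v0 /poisson_cdf big_ord0 subr0. Qed.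

Lemma calm_prob0 : calm_prob 0 = 1.
Proof.
rewrite /calm_prob -(prednK M_gt0) big_ord_recl/= size_sum_prob0 eqxx mul1r gamma_cdf0//.
by rewrite big1 ?addr0// => i _; rewrite size_sum_prob0 mul0r.
Qed.

Lemma calm_prob_ge0 l : 0 <= calm_prob l.
Proof. by rewrite -lee_fin -calm_law. Qed.

Lemma calm_prob_eq0 l : (M.-1 < l)%N -> calm_prob l = 0.
Proof.
move=> Ml; rewrite /calm_prob big1// => m _.
by rewrite (renewal_eq0 size_sum_probS) ?mul0r//; have := ltn_ord m; lia.
Qed.

(** Exchange the sums over the number of attacks and over their total size, and
    apply [renewal_density]. *)
Lemma sum_calm_prob : \sum_(l < M.-1.+1) calm_prob l =
  1 + a * \sum_(m < M.-1) gamma_cdf xi m.+1 V.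
Proof.
rewrite (prednK M_gt0) /calm_prob exchange_big/=.
under eq_bigr do rewrite -mulr_suml.
rewrite -[in LHS](prednK M_gt0) big_ord_recl/= (renewal_density bE size_sum_prob0 size_sum_probS)//.
rewrite gamma_cdf0// mul1r mulr_sumr; congr (_ + _); apply: eq_bigr => i _.
rewrite -[bump 0 i]/(i.+1) (renewal_density bE size_sum_prob0 size_sum_probS)//.
by rewrite ltnS; exact: ltn_ord.
Qed.

End Calm.

(** * Wald's argument *)

Section Wald.
Context d (T : measurableType d) (R : realType) (P : probability T R).
Context (lam mu xi a b : R) (t : nat -> {RV P >-> R}) (n : nat -> {RV P >-> nat})
  (w : nat -> nat -> {RV P >-> R}) (delta : nat -> {RV P >-> R}).
Hypothesis model : network_attack lam mu xi a b t n w delta.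
Hypothesis lam_gt0 : 0 < lam.
Hypothesis mu_gt0 : 0 < mu.
Hypothesis xi_gt0 : 0 < xi.
Hypothesis a_gt0 : 0 < a.
Hypothesis a_lt1 : a < 1.
Hypothesis bE : b = 1 - a.
Variables (M : nat) (V : R).
Hypothesis M_gt0 : (0 < M)%N.
Hypothesis V_gt0 : 0 < V.
Local Notation G := (source_sigma t n w delta).
Local Notation blockT J := (g_sigma_algebraType (block G J)).
Local Notation calm := (calm n w M V).

Definition clock_sources : set source := [set s | s = Times \/ exists k, s = Gap k].

(** The sources that decide whether attack [l] strikes before the passage is
    observed. *)
Definition past l : set source := clock_sources `|` attacks_below l.

Lemma measurable_strikes_block (J : set source) k i l : clock_sources `<=` J ->
  measurable_fun setT (strikes t delta k i l : blockT J -> bool).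
Proof.
move=> sJ; have mt j : measurable_fun setT (t j : blockT J -> R).
  by apply: measurable_times; apply: sJ; left.
have mtau j : measurable_fun setT (observation_time delta j : blockT J -> R).
  by apply: measurable_observation_time => i' _; apply: sJ; right; exists i'.
apply: measurable_and; last exact: measurable_fun_ler.
exact: (measurable_seen (u := fun j => t j : blockT J -> R)
  (s := observation_time delta k : blockT J -> R)).
Qed.

(** Indicator that attack [l] strikes before the passage is observed (see
    [struck_passage]), in a form that displays on which sources it depends. *)
Definition struck l (omega : T) : \bar R :=
  (\sum_(k <oo) \sum_(i < l.+1) (strikes t delta k i l omega && calm i omega)%:R%:E)%E.

Lemma struck_ge0 l omega : (0 <= struck l omega)%E.
Proof.
by apply: nneseries_ge0 => k _ _; apply: sume_ge0 => i _; rewrite lee_fin.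
Qed.

Lemma measurable_struck_piece l k (i : 'I_l.+1) :
  measurable_fun setT (fun omega : blockT (past l) => strikes t delta k i l omega && calm i omega).
Proof.
apply: measurable_and; first by apply: measurable_strikes_block => s; left.
apply: measurable_calm => s [[j -> ji]|[j [j' [-> ji]]]]; right.
  by left; exists j => //; have := ltn_ord i; lia.
by right; exists j, j'; split => //; have := ltn_ord i; lia.
Qed.

Lemma measurable_struck l : measurable_fun setT (struck l : blockT (past l) -> \bar R).
Proof.
apply: ge0_emeasurable_sum => [k omega _ _|k _].
  by apply: sume_ge0 => i _; rewrite lee_fin.
apply: emeasurable_sum => i.
exact: (@measurable_fun_bool_EFin _ (blockT (past l)) R _ (measurable_struck_piece k i)).
Qed.

Lemma measurable_block (J : set source) d' (U : measurableType d') (f : T -> U) :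
  measurable_fun setT (f : blockT J -> U) -> measurable_fun setT f.
Proof. by move=> mf; apply: (measurableT_comp mf); exact: measurable_id_block. Qed.

Lemma integral_struck l : (\int[P]_omega struck l omega =
  \sum_(k <oo) \sum_(i < l.+1)
     P [set omega | strikes t delta k i l omega] * (calm_prob xi n M V i)%:E)%E.
Proof.
rewrite /struck integral_nneseries//; last 2 first.
- move=> k; apply: emeasurable_sum => i; apply: measurable_fun_bool_EFin.
  exact: measurable_block (measurable_struck_piece k i).
- by move=> k omega _; apply: sume_ge0 => i _; rewrite lee_fin.
apply: eq_eseriesr => k _; rewrite ge0_integral_sum//; last first.
  move=> i; apply: measurable_fun_bool_EFin.
  exact: measurable_block (measurable_struck_piece k i).
apply: eq_bigr => i _; rewrite -measure_bool; last first.
  exact: measurable_block (measurable_struck_piece k i).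
rewrite -(calm_law model)// -(model_block_indep model (J1 := clock_sources) (J2 := attacks_below i)).
- by congr (P _); apply/seteqP; split => omega /= /andP.
- by apply/seteqP; split => // s [[->|[j ->]]] [[i' //]|[i' [j' []]]].
- by apply: (@measurable_bool_set _ (blockT clock_sources)); exact: measurable_strikes_block.
- by apply: (@measurable_bool_set _ (blockT (attacks_below i))); exact: measurable_calm.
Qed.

Lemma sum_integral_struck :
  (\sum_(l <oo) \int[P]_omega struck l omega =
   (lam / mu + \sum_(l < M.-1.+1) calm_prob xi n M V l)%:E)%E.
Proof.
under eq_eseriesr do rewrite integral_struck.
apply: (nneseries_strikes model) => //.
- exact: calm_prob0.
- by move=> l; exact: (calm_prob_ge0 model).
- by move=> l; exact: (calm_prob_eq0 model).
Qed.

Lemma nneseries_geometric : (\sum_(j <oo) (b ^+ j)%:E = (a^-1)%:E)%E.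
Proof.
apply: nneseries_EFin.
have b01 : `|b| < 1.
  by rewrite bE ger0_norm ?subr_ge0 ?(ltW a_lt1)// ltrBlDr ltrDl.
rewrite (_ : (fun m => _) = fun m => a^-1 * (1 - b ^+ m)); last first.
  apply/funext => m; rewrite -(geometric_mass bE) mulr_sumr; apply: eq_bigr => i _.
  by rewrite mulKf// gt_eqF.
rewrite -[X in _ --> X]mulr1; apply: cvgMr; rewrite -[X in _ --> X]subr0.
by apply: cvgB; [exact: cvg_cst | exact: cvg_expr].
Qed.

(* [c l j] is the value given to node [j] of attack [l]: 1 to count the nodes,
   or the weight of the node. *)
Variables (c : nat -> nat -> T -> R) (z : R).
Hypothesis c_ge0 : forall l j omega, 0 <= c l j omega.
Hypothesis mc : forall l j,
  measurable_fun setT (c l j : blockT [set Weight l j] -> R).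
Hypothesis cE : forall l j, (\int[P]_omega (c l j omega)%:E = z%:E)%E.

Definition contribution l (omega : T) : \bar R :=
  (\sum_(j <oo) (c l j omega * (j < n l omega)%N%:R)%:E)%E.

Lemma contribution_ge0 l omega : (0 <= contribution l omega)%E.
Proof. by apply: nneseries_ge0 => j _ _; rewrite lee_fin mulr_ge0. Qed.

Definition attack_sources l : set source := [set s | s = Size l \/ exists j, s = Weight l j].

Lemma measurable_contribution_piece l j :
  measurable_fun setT (fun omega : blockT (attack_sources l) => c l j omega * (j < n l omega)%N%:R).
Proof.
apply: measurable_funM.
  move=> _ B mB; rewrite setTI.
  have := mc (l := l) (j := j) measurableT mB; rewrite setTI.
  apply: sub_smallest2r => // A [s /= -> sA].
  by exists (Weight l j) => //; right; exists j.
apply: (@measurable_fun_nat _ (blockT (attack_sources l)) _ R (n l) (fun m => (j < m)%N%:R)).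
by apply: measurable_size; left.
Qed.

Lemma measurable_contribution l :
  measurable_fun setT (contribution l : blockT (attack_sources l) -> \bar R).
Proof.
apply: ge0_emeasurable_sum => [j omega _ _|j _]; first by rewrite lee_fin mulr_ge0.
by apply/measurable_EFinP; exact: measurable_contribution_piece.
Qed.

Lemma integral_contribution l : (\int[P]_omega contribution l omega = (z / a)%:E)%E.
Proof.
rewrite /contribution integral_nneseries//; last 2 first.
- move=> j; apply/measurable_EFinP.
  exact: measurable_block (@measurable_contribution_piece l j).
- by move=> j omega _; rewrite lee_fin mulr_ge0.
transitivity (\sum_(j <oo) z%:E * (b ^+ j)%:E)%E.
  apply: eq_eseriesr => j _.
  rewrite -(size_gt_law model a_gt0 a_lt1 bE l) -(cE l j).
  rewrite measure_bool; last exact: (measurable_size_pred n l (fun m => j < m)%N).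
  under [LHS]eq_integral do rewrite EFinM.
  apply: (@ge0_integral_indepM _ _ _ P _ _ _ _ (id : T -> blockT [set Weight l j])
    (id : T -> blockT [set Size l]) _ _ _ (fun omega => (c l j omega)%:E)
    (fun omega => (j < n l omega)%N%:R%:E)).
  - exact: measurable_id_block.
  - exact: measurable_id_block.
  - move=> A B mA mB; apply: (model_block_indep model (J1 := [set Weight l j]) (J2 := [set Size l])) => //.
    by apply/seteqP; split => // s [/= ->].
  - exact/measurable_EFinP.
  - apply: measurable_fun_bool_EFin; apply: (measurable_fun_nat (fun m => j < m)%N).
    exact: measurable_size.
  - by move=> omega; rewrite lee_fin.
  - by move=> omega; rewrite lee_fin.
rewrite nneseriesZl; last first.
  by move=> j _; rewrite lee_fin exprn_ge0// bE subr_ge0 ltW.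
by rewrite nneseries_geometric -EFinM.
Qed.

(** The contribution of attack [l] is independent of [struck l], which depends
    on the clocks and on the earlier attacks only. *)
Lemma wald : (\int[P]_omega (\sum_(l <oo) contribution l omega * struck l omega) =
  (z / a * (lam / mu + \sum_(l < M.-1.+1) calm_prob xi n M V l))%:E)%E.
Proof.
rewrite integral_nneseries//; last 2 first.
- move=> l; apply: emeasurable_funM.
    exact: measurable_block (@measurable_contribution l).
  exact: measurable_block (@measurable_struck l).
- by move=> l omega _; rewrite mule_ge0// ?contribution_ge0// struck_ge0.
rewrite EFinM -sum_integral_struck -nneseriesZl; last first.
  by move=> l _; apply: integral_ge0 => omega _; exact: struck_ge0.
apply: eq_eseriesr => l _; rewrite -(integral_contribution l).
apply: (@ge0_integral_indepM _ _ _ P _ _ _ _ (id : T -> blockT (attack_sources l))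
    (id : T -> blockT (past l)) _ _ _ (contribution l) (struck l)).
- exact: measurable_id_block.
- exact: measurable_id_block.
- move=> A B mA mB; apply: (model_block_indep model (J1 := attack_sources l) (J2 := past l)) => //.
  apply/seteqP; split => // s [[->|[j ->]] []].
  + by move=> [|[]].
  + by move=> [[i [<-]]|[i [j' []]]] //; rewrite ltnn.
  + by move=> [|[]].
  + by move=> [[i //]|[i [j' [[<- _]]]]]; rewrite ltnn.
- exact: measurable_contribution.
- exact: measurable_struck.
- exact: contribution_ge0.
- exact: struck_ge0.
Qed.

End Wald.

(** * The observed process path by path *)

Section Pathwise.
Context d (T : measurableType d) (R : realType) (P : probability T R).
Context (t : nat -> {RV P >-> R}) (n : nat -> {RV P >-> nat})
  (w : nat -> nat -> {RV P >-> R}) (delta : nat -> {RV P >-> R}).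
Variables (M : nat) (V : R).
Hypothesis M_gt0 : (0 < M)%N.
Hypothesis V_gt0 : 0 < V.
Local Notation tau := (observation_time delta).
Local Notation calm := (calm n w M V).

Variable omega : T.
Hypothesis good : good_times t delta omega.
Hypothesis n_gt0 : forall k, (0 < n k omega)%N.
Hypothesis w_ge0 : forall k j, 0 <= w k j omega.
Hypothesis passed : forall l, exists k, t l omega <= tau k omega.

Let tS : increasing_times t omega := good.1.

Lemma attack_weight_ge0 l : 0 <= attack_weight n w l omega.
Proof. by apply: sumr_ge0 => j _. Qed.

Lemma observed_nodes_seen i k : seen t i (tau k omega) omega ->
  observed_nodes t n delta k omega = ((size_sum n i omega)%:R)%:E.
Proof.
move=> si; rewrite /observed_nodes /nodes_lost (@nneseries_prefix _ _ _ i)//.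
- by rewrite /size_sum natr_sum sumEFin.
- by move=> l; rewrite (increasing_times_seen _ tS si).
Qed.

Lemma observed_weight_seen i k : seen t i (tau k omega) omega ->
  observed_weight t n w delta k omega = (weight_sum n w i omega)%:E.
Proof.
move=> si; rewrite /observed_weight /weight_lost (@nneseries_prefix _ _ _ i)//.
- by rewrite sumEFin.
- by move=> l; rewrite lee_fin attack_weight_ge0.
- by move=> l; rewrite (increasing_times_seen _ tS si).
Qed.

Lemma exited_seen i k : seen t i (tau k omega) omega ->
  exited M V t n w delta omega k <-> ~~ calm i omega.
Proof.
move=> si; rewrite /exited (observed_nodes_seen si) (observed_weight_seen si).
rewrite !lee_fin !lte_fin ler0n ltr_nat (_ : 0 <= weight_sum n w i omega); last first.
  by apply: sumr_ge0 => j _; exact: attack_weight_ge0.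
rewrite /= /calm; split=> [h|/negP h [h1 h2]]; last by apply: h; rewrite h1.
by apply/negP => /andP[h1 h2]; apply: h.
Qed.

Lemma calm_le i j : (i <= j)%N -> calm j omega -> calm i omega.
Proof.
move=> ij /andP[sM wV]; apply/andP; split.
  apply: leq_ltn_trans sM; rewrite /size_sum -(subnKC ij) big_split_ord/=.
  exact: leq_addr.
apply: le_lt_trans wV; rewrite /weight_sum -(subnKC ij) big_split_ord/= lerDl.
by apply: sumr_ge0 => k _; exact: attack_weight_ge0.
Qed.

(** Every attack takes at least one node, so [M] attacks suffice. *)
Lemma exited_late k : t M.-1 omega <= tau k omega -> exited M V t n w delta omega k.
Proof.
move=> tM [/andP[_ +] _]; apply/negP; rewrite -leNgt.
rewrite /observed_nodes /nodes_lost.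
apply: le_trans (nneseries_lim_ge M _); last by move=> l _ _; rewrite lee_fin.
rewrite big_mkord (eq_bigl xpredT); last first.
  move=> l; apply: le_trans tM; rewrite increasing_times_mono//.
  by have := ltn_ord l; lia.
rewrite sumEFin lee_fin -natr_sum ler_nat -[X in (X <= _)%N]card_ord -sum1_card.
by apply: leq_sum => l _; exact: n_gt0.
Qed.

Lemma passage_indexP : exists2 k,
  passage_index M V t n w delta omega = Some k &
  exited M V t n w delta omega k /\
  (forall j, (j < k)%N -> ~ exited M V t n w delta omega j).
Proof.
have [k tk] := passed M.-1.
have ex : exists k, `[< exited M V t n w delta omega k >].
  by exists k; apply/asboolP; exact: exited_late.
rewrite /passage_index; case: pselect => [ex'|/(_ ex)//].
case: ex_minnP => k0 /asboolP ek kmin; exists k0 => //; split => // j jk ej.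
by have := kmin j (asboolT ej); rewrite leqNgt jk.
Qed.

Lemma strikes_uniq k k' i i' l : (i <= l)%N -> (i' <= l)%N ->
  strikes t delta k i l omega -> strikes t delta k' i' l omega -> k = k' /\ i = i'.
Proof.
have aux k1 k2 i1 i2 : (i1 <= l)%N -> (i2 <= l)%N ->
    strikes t delta k1 i1 l omega -> strikes t delta k2 i2 l omega -> (k1 <= k2)%N.
  move=> il1 il2 /andP[s1 _] /andP[_ t2]; rewrite leqNgt; apply/negP => k21.
  have := le_trans t2 (good_tau_le good k21).
  by rewrite (increasing_times_seen _ tS s1) ltnNge il1.
move=> il il' s s'; have kk : k = k'.
  by apply/eqP; rewrite eqn_leq (aux _ _ _ _ il il' s s') (aux _ _ _ _ il' il s' s).
split => //; case/andP: s => si _; case/andP: s' => si' _.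
by apply: (seen_inj tS si); rewrite kk.
Qed.

(** The last observation before attack [l] precedes the passage exactly when
    the attacks that it sees are calm: calmness can only be lost as more attacks
    are seen. *)
Lemma struck_passage k : exited M V t n w delta omega k ->
  (forall j, (j < k)%N -> ~ exited M V t n w delta omega j) ->
  forall l, struck t n w delta M V l omega = (t l omega <= tau k omega)%R%:R%:E.
Proof.
move=> ek nek l; rewrite /struck.
have piece j i : strikes t delta j i l omega -> calm i omega -> (t l omega <= tau k omega).
  move=> /andP[sj tj] ci; apply: le_trans tj (good_tau_le good _).
  rewrite ltnNge; apply/negP => kj.
  have /andP[_ ti] := sj.
  have [i0 i0i si0] := seen_exists tS (le_lt_trans (good_tau_le good kj) ti).
  by move/(exited_seen si0): ek; rewrite (calm_le i0i ci).
case: (leP (t l omega) (tau k omega)) => tl; last first.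
  rewrite eseries0// => j _ _; apply: big1 => i _.
  by case: andP => // -[sj ci]; have := piece _ _ sj ci; rewrite leNgt tl.
have ex : exists j, t l omega <= tau j omega by exists k.
case: (ex_minnP ex) => -[|j] tj jmin.
  have : 0 < t l omega by apply: lt_le_trans tS.1 _; rewrite increasing_times_mono.
  by rewrite ltNge; move: tj; rewrite observation_time0 => ->.
have tjl : tau j omega < t l omega.
  by rewrite ltNge; apply/negP => /jmin; rewrite ltnn.
have [i il si] := seen_exists tS tjl.
have jk : (j < k)%N by exact: jmin.
have ci : calm i omega by apply: contrapT => /negP /(exited_seen si); exact: nek.
have sj : strikes t delta j i l omega by rewrite /strikes si.
rewrite (nneseriesD1 (n := j))//; last by move=> *; apply: sume_ge0 => *; rewrite lee_fin.
rewrite eseries0 ?adde0; last first.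
  move=> j' _ /= /eqP jj; apply: big1 => i' _; case: andP => // -[sj' _].
  by have [] := strikes_uniq (ltn_ord i' : (i' <= l)%N) il sj' sj.
rewrite (bigD1 (Ordinal (il : (i < l.+1)%N)))//= sj ci big1 ?adde0// => i' /eqP ii.
case: andP => // -[sj' _].
have [_ e] := strikes_uniq (ltn_ord i' : (i' <= l)%N) il sj' sj.
by case: ii; apply: val_inj.
Qed.

Lemma at_passage_struck (x : nat -> R) (Y : nat -> T -> \bar R) :
  (forall l, 0 <= x l) ->
  (forall k, Y k omega = \sum_(l <oo | (t l omega <= tau k omega)%R) (x l)%:E)%E ->
  at_passage (passage_index M V t n w delta) Y omega =
  (\sum_(l <oo) (x l)%:E * struck t n w delta M V l omega)%E.
Proof.
move=> x0 YE; have [k kE [ek nek]] := passage_indexP.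
rewrite /at_passage kE YE eseries_mkcond; apply: eq_eseriesr => l _.
by rewrite (struck_passage ek nek); case: ifP; rewrite ?mule1 ?mule0.
Qed.

End Pathwise.

(** * Expectations at the passage *)

Lemma sum_gamma_tails (R : realType) (x : R) M :
  \sum_(m < M) (1 - poisson_cdf m.+1 x) =
  M%:R - M%:R * expR (- x) * \sum_(0 <= j < M) x ^+ j / j`!%:R
  + expR (- x) * \sum_(0 <= j < M) x ^+ j * inv_pred_fact R j.
Proof.
have cdfE m : poisson_cdf m x = expR (- x) * \sum_(0 <= j < m) x ^+ j / j`!%:R.
  by rewrite /poisson_cdf big_mkord mulr_sumr; apply: eq_bigr => j _; rewrite mulrC.
have predE m : m%:R * (x ^+ m / m`!%:R) = x ^+ m * inv_pred_fact R m.
  case: m => [|m]; first by rewrite /inv_pred_fact mulr0 mul0r.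
  by rewrite /inv_pred_fact factS natrM; field; rewrite nat1r !pnatr_eq0 -lt0n fact_gt0.
elim: M => [|M IH]; first by rewrite big_ord0 !big_geq// !mulr0 subrr addr0.
rewrite big_ord_recr/= IH cdfE !(@big_nat_recr _ _ _ M)//= -predE -natr1.
ring.
Qed.

Section Expectations.
Context d (T : measurableType d) (R : realType) (P : probability T R).
Context (lam mu xi a b : R) (t : nat -> {RV P >-> R}) (n : nat -> {RV P >-> nat})
  (w : nat -> nat -> {RV P >-> R}) (delta : nat -> {RV P >-> R}).
Hypothesis model : network_attack lam mu xi a b t n w delta.
Hypothesis lam_gt0 : 0 < lam.
Hypothesis mu_gt0 : 0 < mu.
Hypothesis xi_gt0 : 0 < xi.
Hypothesis a_gt0 : 0 < a.
Hypothesis a_lt1 : a < 1.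
Hypothesis bE : b = 1 - a.
Variables (M : nat) (V : R).
Hypothesis M_gt0 : (0 < M)%N.
Hypothesis V_gt0 : 0 < V.
Local Notation tau := (observation_time delta).

Definition mean_nodes : R := (lam + b * mu) / (a * mu) + M%:R
  - (M%:R - 1) * expR (- (xi * V)) * \sum_(0 <= j < M.-1) (xi * V) ^+ j / j`!%:R
  + expR (- (xi * V)) * \sum_(0 <= j < M.-1) (xi * V) ^+ j * inv_pred_fact R j.

Lemma mean_nodesE :
  a^-1 * (lam / mu + \sum_(l < M.-1.+1) calm_prob xi n M V l) = mean_nodes.
Proof.
rewrite (sum_calm_prob model)//.
under eq_bigr do rewrite /gamma_cdf V_gt0.
rewrite sum_gamma_tails /mean_nodes bE.
rewrite -[in M%:R - 1](prednK M_gt0) -[in X in _ = _ + X - _ + _](prednK M_gt0) -natr1.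
by field; rewrite !gt_eqF.
Qed.

Lemma sum_first_nodes (x : nat -> R) m : (forall j, 0 <= x j) ->
  (\sum_(j <oo) (x j * (j < m)%N%:R)%:E = (\sum_(j < m) x j)%:E)%E.
Proof.
move=> x0; rewrite -sumEFin -(@nneseries_prefix _ (fun j => (x j)%:E) (fun j => (j < m)%N))//.
rewrite [RHS]eseries_mkcond; apply: eq_eseriesr => j _.
by case: ifP; rewrite ?mulr1 ?mulr0.
Qed.

(** Both components of the process are sums over the nodes taken; they differ
    only in the value [c l j] given to node [j] of attack [l]. *)
Lemma at_passage_mean (c : nat -> nat -> T -> R) (z : R) (Y : nat -> T -> \bar R) :
  (forall l j omega, 0 <= c l j omega) ->
  (forall l j, measurable_fun setT
    (c l j : g_sigma_algebraType (block (source_sigma t n w delta) [set Weight l j]) -> R)) ->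
  (forall l j, (\int[P]_omega (c l j omega)%:E = z%:E)%E) ->
  (forall omega, (forall k j, (0 <= w k j omega)%R) -> forall k, Y k omega =
    \sum_(l <oo | (t l omega <= tau k omega)%R) (\sum_(j < n l omega) c l j omega)%:E)%E ->
  (\int[P]_omega at_passage (passage_index M V t n w delta) Y omega =
   (z * mean_nodes)%:E)%E.
Proof.
move=> c0 mc cE YE.
rewrite -mean_nodesE mulrA -(wald model _ _ _ _ _ _ _ _ c0 mc cE)//.
apply: ae_eq_integral_setT.
apply: filterS3 (ae_good_times model) (ae_times_passed model lam_gt0 mu_gt0)
  (filterI (ae_size_gt0 model a_gt0 a_lt1 bE) (ae_weight_ge0 model)).
move=> omega good passed [n0 w0].
rewrite (at_passage_struck M_gt0 V_gt0 good n0 w0 passed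
  (x := fun l => \sum_(j < n l omega) c l j omega)).
- apply: eq_eseriesr => l _; congr (_ * _)%E.
  by rewrite /contribution (sum_first_nodes _ (fun j => c0 l j omega)).
- by move=> l; apply: sumr_ge0.
- exact: YE.
Qed.

Lemma integral_nodes_at_passage :
  (\int[P]_omega nodes_at_passage M V t n w delta omega = mean_nodes%:E)%E.
Proof.
rewrite -[mean_nodes]mul1r; apply: (@at_passage_mean (fun _ _ => cst 1)) => //.
  move=> l j; rewrite (integral_cst P measurableT 1%:E) mul1e. exact: probability_setT.
move=> omega w0 k; rewrite /observed_nodes /nodes_lost.
by apply: eq_eseriesr => l _; rewrite sumr_const card_ord.
Qed.

Lemma integral_weight_at_passage :
  (\int[P]_omega weight_at_passage M V t n w delta omega =
   (xi^-1 * mean_nodes)%:E)%E.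
Proof.
(* The weights are nonnegative only almost surely, whereas [at_passage_mean]
   asks for nonnegative values on every path. *)
apply: (@at_passage_mean (fun l j omega => `|w l j omega|)) => //.
- move=> l j; apply: measurableT_comp => //; exact: measurable_weight.
- move=> l j; exact: (integral_abs_exponential xi_gt0 (node_weights_law model l j)).
- move=> omega w0 k; rewrite /observed_weight /weight_lost.
  apply: eq_eseriesr => l _; congr EFin; apply: eq_bigr => j _.
  by rewrite ger0_norm.
Qed.

Lemma expectation_weight k j : ('E_P[w k j] = (xi^-1)%:E)%E.
Proof.
rewrite -(integral_abs_exponential xi_gt0 (node_weights_law model k j)) unlock.
apply: ae_eq_integral_setT; apply: filterS (ae_weight_ge0 model) => omega w0.
by rewrite ger0_norm.
Qed.

End Expectations.

Theorem theorem3p6 (d : measure_display) (T : measurableType d) (R : realType)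
    (P : probability T R) (lam mu xi a b : R) (M : nat) (V : R)
    (t : nat -> {RV P >-> R}) (n : nat -> {RV P >-> nat})
    (w : nat -> nat -> {RV P >-> R}) (delta : nat -> {RV P >-> R})
    (lam_gt0 : 0 < lam) (mu_gt0 : 0 < mu) (xi_gt0 : 0 < xi)
    (a_gt0 : 0 < a) (a_lt1 : a < 1) (b_def : b = 1 - a)
    (M_gt0 : (0 < M)%N) (V_gt0 : 0 < V)
    (model : network_attack lam mu xi a b t n w delta) :
  let EN := (\int[P]_omega nodes_at_passage M V t n w delta omega)%E in
  let EW := (\int[P]_omega weight_at_passage M V t n w delta omega)%E in
  [/\ EW = (xi^-1 *
        ((lam + b * mu) / (a * mu) + M%:R
         - (M%:R - 1) * expR (- (xi * V))
             * \sum_(0 <= j < M.-1) (xi * V) ^+ j / j`!%:R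
         + expR (- (xi * V))
             * \sum_(0 <= j < M.-1) (xi * V) ^+ j * inv_pred_fact R j))%:E,
      EW = ((xi^-1)%:E * EN)%E
    & EW = ('E_P[w 0%N 0%N] * EN)%E].
Proof.
move=> EN EW.
have EWE : EW = (xi^-1 * mean_nodes lam mu xi a b M V)%:E.
  exact: (integral_weight_at_passage model).
have ENE : EN = (mean_nodes lam mu xi a b M V)%:E.
  exact: (integral_nodes_at_passage model).
by split; rewrite EWE // ENE ?(expectation_weight model).
Qed.
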